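(* For every $n\ge 0$ and every $v\in\{0,1\}^n$, $$f_v(q,a,t)=\sum_{d=0}^{n}\langle L_v(x;q,t),\, e_{n-d}h_d\rangle\, a^d,$$ where $e_k$ and $h_k$ are the elementary and complete homogeneous symmetric functions and $\langle\cdot,\cdot\rangle$ is the Hall inner product on symmetric functions (extended coefficientwise in $q,t$).
   Context: Let $\mathbb{N}=\{0,1,2,\dots\}$, $\mathbb{P}=\{1,2,3,\dots\}$. For $\gamma\in\mathbb{N}^n$, $\pi\in\mathbb{P}^n$ let $\operatorname{area}(\gamma)=|\gamma|-\#\{i:\gamma_i>0\}$, $\operatorname{dinv}(\gamma,\pi)=\#\{i<j:\gamma_i=\gamma_j,\ \pi_i>\pi_j\}+\#\{i<j:\gamma_i+1=\gamma_j,\ \pi_i<\pi_j\}$, $x^\pi=\prod_i x_{\pi_i}$, and for $v\in\{0,1\}^n$ let $L_v(x;q,t)=\sum q^{\operatorname{area}(\gamma)}t^{\operatorname{dinv}(\gamma,\pi)}x^\pi$, summed over $\gamma\in\mathbb{N}^n$, $\pi\in\mathbb{P}^n$ with $\gamma_i=0\iff v_i=1$; this is a symmetric function in $x$ with coefficients power series in $q,t$. The series $f_v(q,a,t)$ (which Elias and Hogancamp showed to be the Poincaré series, after regrading, of the triply graded Hochschild/Khovanov–Rozansky homology of a complex $C_v$ attached to $v$) are defined here by the following recurrence. For a binary word $v$ write $|v|$ for its number of $1$'s. Given $v\in\{0,1\}^n$ and $w\in\{0,1\}^{n-|v|}$, form $u\in\{0,1,2\}^n$ by: $u_i=1$ if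 $v_i=1$; if $v_i=0$ and this is the $j$-th zero of $v$ from the left, set $u_i=2w_j$. Let $$P_{v,w}(a,t)=\prod_{i:\,v_i=1}\left(t^{\#\{j<i:\,u_j=1\}+\#\{j>i:\,u_j=2\}}+a\right).$$ Then $f_\emptyset=1$; for $n\ge1$, $f_{0^n}(q,a,t)=(1-q)^{-1}f_{10^{n-1}}(q,a,t)$; and for $v\in\{0,1\}^n$ with $v\ne 0^n$, $$f_v(q,a,t)=\sum_{w\in\{0,1\}^{n-|v|}}q^{\,n-|v|-|w|}P_{v,w}(a,t)\,f_w(q,a,t).$$ Here $(1-q)^{-1}=\sum_{k\ge0}q^k$. *)

(* Defs.v *)
From HB Require Import structures.
From mathcomp Require Import all_boot all_order all_algebra.
From mathcomp Require Import finmap multiset.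
From mathcomp Require Import boolp classical_sets functions cardinality fsbigop.
Set Implicit Arguments.
Unset Strict Implicit.
Unset Printing Implicit Defensive.
Import GRing.Theory.
Local Open Scope mset_scope.
Local Open Scope classical_set_scope.
Local Open Scope ring_scope.

(** Formal power series over [R] in commuting variables indexed by [I], which
    may be infinite.  A monomial is a finite multiset of variables, and a series
    is its family of coefficients. *)
Record fps (I : choiceType) (R : Type) := Fps { coefps : {mset I} -> R }.

Notation "f @_[ m ]" := (coefps f m) (at level 2, format "f @_[ m ]") : ring_scope.

Section FpsZmod.
Variables (I : choiceType) (R : comNzRingType).
Implicit Types (f g h : fps I R) (m : {mset I}).

HB.instance Definition _ := [isNew for @coefps I R].
HB.instance Definition _ := [Equality of fps I R by <:].
HB.instance Definition _ := [Choice of fps I R by <:].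

Lemma fpsP f g : (forall m, f@_[m] = g@_[m]) <-> f = g.
Proof. by split=> [fg|->//]; apply: val_inj; apply: funext. Qed.

Definition fps0 : fps I R := Fps (fun=> 0).
Definition fps_opp f := Fps (fun m => - f@_[m]).
Definition fps_add f g := Fps (fun m => f@_[m] + g@_[m]).

Fact fps_addA : associative fps_add.
Proof. by move=> f g h; apply/fpsP => m /=; rewrite addrA. Qed.
Fact fps_addC : commutative fps_add.
Proof. by move=> f g; apply/fpsP => m /=; rewrite addrC. Qed.
Fact fps_add0 : left_id fps0 fps_add.
Proof. by move=> f; apply/fpsP => m /=; rewrite add0r. Qed.
Fact fps_addN : left_inverse fps0 fps_opp fps_add.
Proof. by move=> f; apply/fpsP => m /=; rewrite addNr. Qed.

HB.instance Definition _ :=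
  GRing.isZmodule.Build (fps I R) fps_addA fps_addC fps_add0 fps_addN.

Definition fps_scale (c : R) f := Fps (fun m => c * f@_[m]).

Fact fps_scaleA a b f : fps_scale a (fps_scale b f) = fps_scale (a * b) f.
Proof. by apply/fpsP => m /=; rewrite mulrA. Qed.
Fact fps_scale1 : left_id 1 fps_scale.
Proof. by move=> f; apply/fpsP => m /=; rewrite mul1r. Qed.
Fact fps_scaleDr : right_distributive fps_scale +%R.
Proof. by move=> c f g; apply/fpsP => m /=; rewrite mulrDr. Qed.
Fact fps_scaleDl f : {morph fps_scale^~ f : a b / a + b}.
Proof. by move=> a b; apply/fpsP => m /=; rewrite mulrDl. Qed.

HB.instance Definition _ := GRing.Zmodule_isLmodule.Build R (fps I R)
  fps_scaleA fps_scale1 fps_scaleDr fps_scaleDl.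

End FpsZmod.

(** Locked, so that unification does not unfold monomials. *)
HB.lock Definition fps1 (I : choiceType) (R : comNzRingType) : fps I R :=
  Fps (fun m => (m == mset0)%:R).
HB.lock Definition fpsX (I : choiceType) (R : comNzRingType) (i : I) : fps I R :=
  Fps (fun m => (m == [mset i])%:R).
Arguments fpsX {I R} i.

Section FpsRing.
Variables (I : choiceType) (R : comNzRingType).
Implicit Types (f g h : fps I R) (m : {mset I}).

Definition factors m : set ({mset I} * {mset I}) :=
  [set p | (p.1 `+` p.2)%mset = m].

Lemma factors_finite m : finite_set (factors m).
Proof.
pose F := [seq (seq_mset (take k s), seq_mset (drop k s)) |
           s <- permutations (m : seq I), k <- iota 0 (size m).+1].
apply: (@sub_finite_set _ _ [set` F]); last exact: finite_seq.
move=> [A' B'] /= def_m; pose A : {mset I} := A'; pose B : {mset I} := B'.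
rewrite /factors /= -[A']/A -[B']/B in def_m *.
apply/allpairsP.
exists ((A : seq I) ++ B, size A); split.
- rewrite mem_permutations; apply/permP => P.
  have perm_m : perm_eq (A ++ B) m.
    apply/allP => x _ /=; rewrite count_cat !count_mem_mset -def_m.
    by rewrite msetE2.
  exact/permP.
- rewrite mem_iota leq0n add0n ltnS -def_m.
  have /perm_size -> : perm_eq (A `+` B)%mset (A ++ B).
    by apply/allP => x _ /=; rewrite count_cat !count_mem_mset msetE2.
  by rewrite size_cat leq_addr.
- by rewrite take_size_cat // drop_size_cat // !seq_mset_id.
Qed.

Definition fps_mul f g :=
  Fps (fun m => \sum_(p \in factors m) f@_[p.1] * g@_[p.2]).

Definition factor_seq m : seq ({mset I} * {mset I}) := fset_set (factors m).

Lemma factor_seq_uniq m : uniq (factor_seq m).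
Proof. exact: fset_uniq. Qed.

Lemma mem_factor_seq m p : (p \in factor_seq m) = ((p.1 `+` p.2)%mset == m).
Proof.
rewrite in_fset_set; last exact: factors_finite.
by apply/idP/eqP; rewrite inE.
Qed.

Lemma fps_mulE f g m :
  (fps_mul f g)@_[m] = \sum_(p <- factor_seq m) f@_[p.1] * g@_[p.2].
Proof. by rewrite /= fsbig_finite //; exact: factors_finite. Qed.

Fact fps_mulC : commutative fps_mul.
Proof.
move=> f g; apply/fpsP => m; rewrite !fps_mulE.
pose sw (p : {mset I} * {mset I}) := (p.2, p.1).
rewrite (perm_big (map sw (factor_seq m))) /=; last first.
  apply: uniq_perm; first exact: factor_seq_uniq.
    by rewrite map_inj_uniq ?factor_seq_uniq // => -[a b] [c d] [-> ->].
  move=> [a b]; rewrite mem_factor_seq /=.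
  apply/idP/mapP => [/eqP <-|[[c d] + [-> ->]]].
    by exists (b, a) => //; rewrite mem_factor_seq /= msetDC.
  by rewrite mem_factor_seq /= msetDC.
by rewrite big_map; apply: eq_bigr => p _; rewrite mulrC.
Qed.

Fact fps_mulA : associative fps_mul.
Proof.
move=> f g h; apply/fpsP => m; rewrite !fps_mulE.
under eq_bigr do rewrite fps_mulE big_distrr /=.
under [in RHS]eq_bigr do rewrite fps_mulE big_distrl /=.
pose T := ({mset I} * {mset I} * {mset I})%type.
pose F (x : T) := f@_[x.1.1] * (g@_[x.1.2] * h@_[x.2]).
pose s1 : seq T := [seq (p.1, q.1, q.2) | p <- factor_seq m, q <- factor_seq p.2].
pose s2 : seq T := [seq (q.1, q.2, p.2) | p <- factor_seq m, q <- factor_seq p.1].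
transitivity (\sum_(x <- s1) F x); first by rewrite big_allpairs_dep.
transitivity (\sum_(x <- s2) F x); last first.
  rewrite big_allpairs_dep; apply: eq_bigr => p _.
  by apply: eq_bigr => q _; rewrite /F /= mulrA.
apply: perm_big; apply: uniq_perm.
- apply: allpairs_uniq_dep; first exact: factor_seq_uniq.
    by move=> p _; exact: factor_seq_uniq.
  move=> _ _ /allpairsPdep[p [q [_ + ->]]] /allpairsPdep[p' [q' [_ + ->]]] /=.
  rewrite !mem_factor_seq; case: p q p' q' => [a b] [c d] [a' b'] [c' d'] /=.
  by move=> /eqP <- /eqP <- [-> -> ->].
- apply: allpairs_uniq_dep; first exact: factor_seq_uniq.
    by move=> p _; exact: factor_seq_uniq.
  move=> _ _ /allpairsPdep[p [q [_ + ->]]] /allpairsPdep[p' [q' [_ + ->]]] /=.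
  rewrite !mem_factor_seq; case: p q p' q' => [a b] [c d] [a' b'] [c' d'] /=.
  by move=> /eqP <- /eqP <- [-> -> ->].
have msetDA' (A B C : {mset I}) : (A `+` (B `+` C) = A `+` B `+` C)%mset.
  by apply/msetP => x; rewrite !msetE2 addnA.
move=> [[a b] c]; apply/allpairsPdep/allpairsPdep.
  move=> [[a' d] [[b' c'] []]]; rewrite !mem_factor_seq /=.
  move=> /eqP <- /eqP <- [-> -> ->].
  by exists ((a' `+` b')%mset, c'), (a', b'); rewrite !mem_factor_seq /= msetDA' !eqxx.
move=> [[d c'] [[a' b'] []]]; rewrite !mem_factor_seq /=.
move=> /eqP <- /eqP <- [-> -> ->].
by exists (a', (b' `+` c')%mset), (b', c'); rewrite !mem_factor_seq /= msetDA' !eqxx.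
Qed.

Fact fps_mul1 : left_id (fps1 I R) fps_mul.
Proof.
have mset0D' (A : {mset I}) : (mset0 `+` A = A)%mset.
  by apply/msetP => x; rewrite !msetE2 mset0E.
move=> f; apply/fpsP => m; rewrite fps_mulE.
rewrite fps1.unlock (bigD1_seq (mset0, m)) ?factor_seq_uniq //=; last first.
  by rewrite mem_factor_seq /= mset0D'.
rewrite eqxx mul1r big_seq_cond big1 ?addr0 // => -[a b].
rewrite mem_factor_seq /= => /andP[/eqP def_m].
case: (a =P mset0) => [a0|_ _]; last by rewrite mul0r.
by rewrite -def_m a0 mset0D' eqxx.
Qed.

Fact fps_mulDl : left_distributive fps_mul +%R.
Proof.
move=> f g h; apply/fpsP => m; rewrite fps_mulE.
rewrite [RHS](_ : _ = (fps_mul f h)@_[m] + (fps_mul g h)@_[m]) // !fps_mulE.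
rewrite -big_split /=.
by apply: eq_bigr => p _; rewrite mulrDl.
Qed.

Fact fps1_neq0 : fps1 I R != 0.
Proof.
apply/eqP => /fpsP/(_ mset0) /eqP.
by rewrite fps1.unlock /= eqxx oner_eq0.
Qed.

HB.instance Definition _ := GRing.Zmodule_isComNzRing.Build (fps I R)
  fps_mulA fps_mulC fps_mul1 fps_mulDl fps1_neq0.

Lemma coef_fps1 m : (1 : fps I R)@_[m] = (m == mset0)%:R.
Proof. by rewrite [1](_ : _ = fps1 I R) // fps1.unlock. Qed.

Lemma coef_fpsX i m : (fpsX i : fps I R)@_[m] = (m == [mset i]%mset)%:R.
Proof. by rewrite fpsX.unlock. Qed.

Lemma coef_fpsXM i f m :
  (fpsX i * f)@_[m] = if i \in m then f@_[(m `\ i)%mset] else 0.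
Proof.
rewrite [LHS]fps_mulE fpsX.unlock; case: ifPn => im; last first.
  rewrite big_seq_cond big1 // => -[a b]; rewrite mem_factor_seq andbT /=.
  move=> /eqP def_m; case: eqP => [a1|]; last by rewrite mul0r.
  by move: im; rewrite -def_m a1 in_msetD in_mset1 eqxx.
rewrite (bigD1_seq ([mset i]%mset, (m `\ i)%mset)) ?factor_seq_uniq //=.
  rewrite eqxx mul1r big_seq_cond big1 ?addr0 // => -[a b].
  rewrite mem_factor_seq /= => /andP[/eqP <-].
  case: (a =P [mset i]%mset) => [->|_ _]; last by rewrite mul0r.
  suff -> : (([mset i] `+` b) `\ i)%mset = b by rewrite eqxx.
  by apply/msetP => x; rewrite !msetE2 addKn.
rewrite mem_factor_seq /=; apply/eqP/msetP => x; rewrite !msetE2 subnKC //.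
by rewrite msetnE; case: eqP => // ->; rewrite -in_mset.
Qed.

(** The sum of a possibly infinite family, coefficient by coefficient; it is
    meaningful when each monomial has a nonzero coefficient in finitely many
    members of the family. *)
Definition fps_sum (T : choiceType) (S : set T) (F : T -> fps I R) : fps I R :=
  Fps (fun m => \sum_(x \in S) (F x)@_[m]).

End FpsRing.

Notation Zqt := (fps 'I_2 int).
Definition q : Zqt := fpsX ord0.
Definition t : Zqt := fpsX ord_max.

(** The series [(1 - q)^{-1}]. *)
Definition geom_q : Zqt := fps_sum [set: nat] (fun k => q ^+ k).

Lemma coef_qX_neq0 k (m : {mset 'I_2}) : (q ^+ k)@_[m] <> 0 -> k = m ord0.
Proof.
elim: k m => [|k IHk] m.
  by rewrite expr0 coef_fps1; case: eqP => // ->; rewrite mset0E.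
rewrite exprS coef_fpsXM; case: ifP => // m0 /IHk ->.
by rewrite msetB1E eqxx subn1 prednK // -in_mset.
Qed.

Lemma coef_geom_q (m : {mset 'I_2}) : geom_q@_[m] = (q ^+ m ord0)@_[m].
Proof.
rewrite /= -(fsbig_widen [set m ord0]) ?fsbig_set1 // => k [_ /= km].
by apply/eqP/negPn/negP => /eqP /coef_qX_neq0.
Qed.

Lemma geom_qE : (1 - q) * geom_q = 1.
Proof.
rewrite mulrBl mul1r; apply/eqP; rewrite subr_eq; apply/eqP/fpsP => m.
rewrite [RHS](_ : _ = (1 : Zqt)@_[m] + (q * geom_q)@_[m]) //.
rewrite coef_fpsXM; case: ifP => m0; rewrite !coef_geom_q.
  rewrite [X in X + _](_ : _ = 0) ?add0r; last first.
    by rewrite coef_fps1; case: eqP m0 => // ->; rewrite in_mset0.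
  rewrite msetB1E eqxx subn1 -{1}[m ord0]prednK ?mset_gt0 //.
  by rewrite exprS coef_fpsXM m0.
by move/negbT: m0; rewrite -mset_eq0 => /eqP ->; rewrite expr0 addr0.
Qed.

(** Formal series in x_1, x_2, ... with coefficients in Z[[q,t]]; the variable
    x_{i+1} is [fpsX i], with [i : nat]. *)
Notation xseries := (fps nat Zqt).

Section L.
Variable n : nat.
Implicit Types (v : n.-tuple bool) (gamma pi : {ffun 'I_n -> nat}).

(** Since variables are indexed from 0, the letters [pi i] start at 0
    instead of 1; only their relative order matters to [dinv]. *)
Definition area gamma : nat :=
  (\sum_(i < n) gamma i - #|[pred i | 0 < gamma i]%N|)%N.

Definition dinv gamma pi : nat :=
  (#|[pred p : 'I_n * 'I_n |
       [&& p.1 < p.2, gamma p.1 == gamma p.2 & pi p.1 > pi p.2]%N]| +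
   #|[pred p : 'I_n * 'I_n |
       [&& p.1 < p.2, (gamma p.1).+1 == gamma p.2 & pi p.1 < pi p.2]%N]|)%N.

Definition xmon pi : xseries := \prod_(i < n) fpsX (pi i).

Definition labelled v : set ({ffun 'I_n -> nat} * {ffun 'I_n -> nat}) :=
  [set p : {ffun 'I_n -> nat} * {ffun 'I_n -> nat} |
     forall i, p.1 i = 0%N <-> tnth v i].

(** The terms are grouped by their monomial in x, because infinitely many
    [gamma] contribute to the coefficient (in Z[[q,t]]) of a given one. *)
Definition L v : xseries :=
  Fps (fun m => fps_sum (labelled v) (fun p =>
    q ^+ area p.1 * t ^+ dinv p.1 p.2 * (xmon p.2)@_[m])).

End L.

Definition e_ (k : nat) : xseries :=
  Fps (fun m => (uniq (m : seq nat) && (size m == k))%:R).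
Definition h_ (k : nat) : xseries := Fps (fun m => (size m == k)%:R).

Definition is_part : set (seq nat) :=
  [set lam | sorted geq lam && (0%N \notin lam)].

Definition h_part (lam : seq nat) : xseries := \prod_(k <- lam) h_ k.

(** The monomial x_1^{lam_1} x_2^{lam_2} ... *)
Definition part_mon (lam : seq nat) : {mset nat} :=
  \big[msetD/mset0]_(i < size lam) msetn (nth 0%N lam i) (i : nat).

Definition h_expansion (g : xseries) (c : seq nat -> Zqt) : Prop :=
  finite_set [set lam | is_part lam /\ c lam <> 0] /\
  g = \sum_(lam \in is_part) c lam *: h_part lam.

Definition h_coord (g : xseries) : seq nat -> Zqt :=
  xget (fun=> 0) [set c | h_expansion g c].

(** The Hall inner product, for which the complete homogeneous basis
    [h_part lam] and the monomial basis m_lam are dual: [g] is expanded in the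
    former, and the coefficient of m_lam in a symmetric [f] is that of
    [part_mon lam].  It is meaningful for symmetric [f] and [g] of bounded
    degree (for [g] not in the span of the [h_part lam], the value is 0). *)
Definition hall (f g : xseries) : Zqt :=
  \sum_(lam \in is_part) h_coord g lam * f@_[part_mon lam].

(** The recurrence takes place in Z[[q,t]][a], the polynomial variable being a.
    Words are 0-indexed; [u_ v w i] is the [i]th letter of u. *)
Definition u_ (v w : seq bool) (i : nat) : nat :=
  if nth false v i then 1%N else (nth false w (count negb (take i v))).*2.

Definition P_ (v w : seq bool) : {poly Zqt} :=
  \prod_(i < size v | nth false v i)
    ((t ^+ (#|[pred j : 'I_(size v) | (j < i)%N && (u_ v w j == 1%N)]| +
            #|[pred j : 'I_(size v) | (i < j)%N && (u_ v w j == 2%N)]|))%:P + 'X).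

Definition ones (v : seq bool) : nat := count id v.

Definition f_rhs (F : seq bool -> {poly Zqt}) (v : seq bool) : {poly Zqt} :=
  \sum_(w : (size v - ones v).-tuple bool)
    (q ^+ (size v - ones v - ones w))%:P * P_ v w * F w.

Fixpoint f_fuel (k : nat) (v : seq bool) : {poly Zqt} :=
  match k, v with
  | k'.+1, _ :: v' =>
      if true \in v then f_rhs (f_fuel k') v
      else geom_q%:P * f_rhs (f_fuel k') (true :: v')
  | _, _ => 1
  end.

Definition f_ (v : seq bool) : {poly Zqt} := f_fuel (size v) v.

Lemma zeros_lt v : true \in v -> (size v - ones v < size v)%N.
Proof.
move=> v1; have : (0 < ones v)%N by rewrite -has_count; apply/hasP; exists true.
have : (ones v <= size v)%N by exact: count_size.
by move: (ones v) (size v) => [//|a] [//|b] _ _; rewrite subSS ltnS leq_subr.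
Qed.

Lemma eq_f_rhs F G v : true \in v ->
  (forall w, (size w < size v)%N -> F w = G w) -> f_rhs F v = f_rhs G v.
Proof.
move=> v1 FG; apply: eq_bigr => w _; congr (_ * _).
by apply: FG; rewrite size_tuple zeros_lt.
Qed.

Lemma f_fuelE k v : (size v <= k)%N -> f_fuel k v = f_ v.
Proof.
have [n] := ubnP (size v); elim: n => // n IHn in k v *.
rewrite /f_; case: v => [|b s] /=; first by case: k.
rewrite ltnS => le_sn; case: k => // k le_sk.
have E (u : seq bool) : size u = (size s).+1 -> true \in u ->
    f_rhs (f_fuel k) u = f_rhs (f_fuel (size s)) u.
  move=> sz_u u1; apply: eq_f_rhs => // w; rewrite sz_u => lt_w.
  rewrite !IHn //; try exact: leq_trans lt_w le_sn; exact: leq_trans lt_w le_sk.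
by rewrite /=; case: ifP => v1; rewrite E // inE eqxx.
Qed.

Lemma f_nil : f_ [::] = 1.
Proof. by []. Qed.

Lemma f_zeros n : f_ (nseq n.+1 false) = geom_q%:P * f_ (true :: nseq n false).
Proof. by rewrite /f_ /= inE /= mem_nseq andbF size_nseq. Qed.

Lemma f_rec v : true \in v ->
  f_ v = \sum_(w : (size v - ones v).-tuple bool)
           (q ^+ (size v - ones v - ones w))%:P * P_ v w * f_ w.
Proof.
case: v => // b s v1; rewrite {1}/f_ /= v1; apply: eq_f_rhs => // w lt_w.
exact: f_fuelE.
Qed.

(* Main.v *)
Require Import Defs.
From mathcomp Require Import all_boot all_order all_algebra.
From mathcomp Require Import zify.
Set Implicit Arguments.
Unset Strict Implicit.
Unset Printing Implicit Defensive.
Import GRing.Theory.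
Local Open Scope ring_scope.

(** Write [gamma] for the heights of the labelled cells, and draw an edge from
    the cell [i] to the cell [j] when [gamma_i = gamma_j] and [j < i], or when
    [gamma_i + 1 = gamma_j] and [i < j].  Then [dinv] is the number of edges along
    which the label increases, and this graph is a unit interval graph for the
    order by height and then from right to left.  Hence, for fixed [gamma], the
    labelled sum is a unicellular LLT polynomial.

    It is symmetric: it suffices to treat two letters, where removing the longest
    edge [(p, r)] changes the sum by [(t - 1) t^c] times the same sum for the graph
    without [p] and [r], so that one can induct on the graph.  Pairing with [e_k]
    amounts to using a starred letter, smaller than all others, for which equal
    letters count as an ascent: the recurrence expressing [e_k] in terms of the
    [h_i] holds because [t^(out-degree) - 1] vanishes at the last starred cell.
    With [n - d] starred cells and [d] cells carrying one larger letter, each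
    starred cell contributes [t] to the power its out-degree, so that
      [\sum_d a^d <L_v, e_(n-d) h_d> =
       \sum_gamma q^(area gamma) \prod_i (a + t^(outdeg i))].

    Splitting off the cells of height 0 shows that the right-hand side satisfies
    the recurrence of [f_v] when [v] has a 1.  When [v = 0^n], all heights can be
    lowered by one, and the rotation [(x_1, .., x_n, y + 1) -> (y, x_1, .., x_n)]
    preserves the product of the weights and lowers the total height by one, which
    gives the factor [1 / (1 - q)].  All infinite sums over [gamma] are compared
    modulo powers of [q] with their truncations to bounded heights. *)

(** * Two-letter symmetry of unit interval graphs *)

Section TwoLetters.
Variables (T : finType) (rk : T -> nat) (R : comNzRingType) (t : R).
Hypothesis rk_inj : injective rk.
Implicit Types (E : rel T) (S A : {set T}) (p r x y : T).

(* The edges of a unit interval order: whatever lies between the ends of an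
   edge, in the order of the ranks, is an edge. *)
Definition unit_interval E S :=
  {in S &, forall p r, E p r -> (rk p < rk r)%N} /\
  {in S &, forall p r, {in S &, forall x y, E p r ->
     (rk p <= rk x)%N -> (rk x < rk y)%N -> (rk y <= rk r)%N -> E x y}}.

Lemma unit_intervalS E S S' :
  S' \subset S -> unit_interval E S -> unit_interval E S'.
Proof.
move=> /subsetP sub [E1 E2]; split.
  by move=> p r /sub pS /sub rS; apply: E1.
by move=> p r /sub pS /sub rS x y /sub xS /sub yS; apply: E2.
Qed.

(** When the cells of [S] carry two letters and [A] holds the smaller one, these are the ascending
    edges. *)
Definition asc_in E S A : nat :=
  (\sum_(x in S) \sum_(y in S) [&& x \in A, y \notin A & E x y])%N.

Definition edges E S : {set T * T} :=
  [set e : T * T | [&& e.1 \in S, e.2 \in S & E e.1 e.2]].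

Definition del_edge E p r : rel T := fun x y => E x y && ((x, y) != (p, r)).

Lemma asc_in_del_edge E S A p r : p \in S -> r \in S -> E p r ->
  asc_in E S A = ((p \in A) && (r \notin A) + asc_in (del_edge E p r) S A)%N.
Proof.
move=> pS rS Epr; pose d x y := [&& x == p, y == r, p \in A & r \notin A].
transitivity (\sum_(x in S) \sum_(y in S)
    (d x y + [&& x \in A, y \notin A & del_edge E p r x y]))%N.
  apply: eq_bigr => x _; apply: eq_bigr => y _; rewrite /d /del_edge xpair_eqE.
  have [->|_] := eqVneq x p; last by rewrite andbT.
  have [->|_] := eqVneq y r; last by rewrite andbT.
  by rewrite Epr /= !andbF andbT addn0.
under eq_bigr do rewrite big_split /=.
rewrite big_split /= -/(asc_in (del_edge E p r) S A); congr (_ + _)%N.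
rewrite (big_setD1 p) //= [X in (X + _)%N](big_setD1 r) //= /d !eqxx /=.
rewrite big1 => [|y /setD1P[/negPf -> //]].
rewrite big1 ?addn0 // => x /setD1P[/negPf -> _].
exact: big1.
Qed.

(** An edge that encloses [(p, r)] is not longer than it, so by injectivity of the ranks it is
    [(p, r)] itself. Hence the deleted edge was not forced by any remaining one. *)
Lemma unit_interval_del_edge E S p r : p \in S -> r \in S -> E p r ->
    {in S &, forall x y, E x y -> (rk y - rk x <= rk r - rk p)%N} ->
  unit_interval E S -> unit_interval (del_edge E p r) S.
Proof.
move=> pS rS Epr maxE [E1 E2]; split.
  by move=> x y xS yS /andP[/E1 ltxy _]; apply: ltxy.
move=> p1 r1 p1S r1S x y xS yS /andP[Ep1 ne1] le_px lt_xy le_yr.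
rewrite /del_edge (E2 p1 r1) //=; apply: contraNneq ne1 => -[xp yr].
have := maxE p1 r1 p1S r1S Ep1; rewrite xp yr in le_px lt_xy le_yr *.
by rewrite xpair_eqE -!(inj_eq rk_inj) => le_d; apply/andP; split; apply/eqP; lia.
Qed.

(** By maximality, an edge out of [p] ends no later than [r], and an edge into [r] starts no earlier
    than [p]. In both cases [y] lies between them, and the edge [(p, r)] forces the other edge. *)
Lemma edge_through E S p r y : p \in S -> r \in S -> E p r ->
    {in S &, forall x y, E x y -> (rk y - rk x <= rk r - rk p)%N} ->
    unit_interval E S -> y \in (S :\ p) :\ r ->
  del_edge E p r p y = del_edge E p r y r.
Proof.
move=> pS rS Epr maxE [E1 E2] /setD1P[yr /setD1P[yp yS]].
rewrite /del_edge !xpair_eqE !eqxx (negPf yr) (negPf yp) !andbT /=.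
have lt_pr := E1 p r pS rS Epr.
have [ne_r ne_p] : rk y != rk r /\ rk y != rk p by rewrite !(inj_eq rk_inj).
apply/idP/idP => Ey.
  have := E1 _ _ pS yS Ey; have := maxE _ _ pS yS Ey => ? ?.
  by apply: (E2 p r) => //; lia.
have := E1 _ _ yS rS Ey; have := maxE _ _ yS rS Ey => ? ?.
by apply: (E2 p r) => //; lia.
Qed.

(** A cell [y] of [S'] can only contribute through [E p y] if it is outside [A], and through [E y r]
    if it is inside. As these agree, the part of the count that involves [p] or [r] does not depend
    on [A]. *)
Lemma asc_in_fixed E S A p r : p != r -> p \in S -> r \in S ->
    let S' := (S :\ p) :\ r in
    ~~ E p r -> {in S', forall y, E p y = E y r} -> A \subset S' ->
  asc_in E S (p |: A) = (\sum_(y in S') E p y + asc_in E S' A)%N.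
Proof.
move=> pr pS rS S' Epr Ethrough AS'.
have rSp : r \in S :\ p by rewrite !inE eq_sym pr.
have rA : r \notin p |: A.
  rewrite !inE negb_or eq_sym pr; apply/negP => /(subsetP AS').
  by rewrite !inE eqxx.
have inA x : x \in S' -> (x \in p |: A) = (x \in A).
  by rewrite !inE => /and3P[_ /negPf ->].
rewrite /asc_in (big_setD1 p) //= [X in (_ + X)%N](big_setD1 r rSp) /= -/S'.
rewrite [X in (_ + (X + _))%N]big1 ?add0n; last by move=> y _; rewrite (negPf rA).
rewrite [X in (X + _)%N](big_setD1 p) //= [X in (_ + X + _)%N](big_setD1 r rSp) /=.
rewrite -/S' setU11 /= (negPf Epr) andbF !add0n.
rewrite [X in (_ + X)%N](_ : _ = \sum_(x in S') ((x \in A) && E x r) + asc_in E S' A)%N.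
  rewrite addnA; congr (_ + _)%N; rewrite -big_split /=.
  apply: eq_bigr => y yS'; rewrite inA // -Ethrough //.
  by case: (y \in A); rewrite ?addn0.
rewrite /asc_in -big_split /=; apply: eq_bigr => x xS'.
rewrite (big_setD1 p) //= (big_setD1 r rSp) /= -/S' setU11 andbF add0n inA // rA.
by congr (_ + _)%N; apply: eq_bigr => y yS'; rewrite inA.
Qed.

(** Induction on the number of cells and edges, deleting a longest edge; without edges,
    complementation in [S] suffices. The weight [g] is arbitrary because the correction term comes
    with a shifted weight. *)
Lemma two_letter_symmetry E S (g : nat -> R) : unit_interval E S ->
  \sum_(A : {set T} | A \subset S) g #|A| * t ^+ asc_in E S A =
  \sum_(A : {set T} | A \subset S) g #|S :\: A| * t ^+ asc_in E S A.
Proof.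
have [n] := ubnP (#|S| + #|edges E S|); elim: n => // n IHn in E S g *.
rewrite ltnS => le_n uiE.
case: (set_0Vmem (edges E S)) => [E0|[e0 e0E]].
  have asc0 A : asc_in E S A = 0%N.
    rewrite /asc_in big1 // => x xS; rewrite big1 // => y yS.
    have := in_set0 (x, y); rewrite -E0 inE xS yS /= => ->.
    by rewrite !andbF.
  rewrite (reindex_onto (fun A => S :\: A) (fun A => S :\: A)) /=.
    apply: eq_big => [A|A _]; last by rewrite !asc0.
    rewrite subsetDl /= setDDr setDv set0U; apply/eqP/idP => [<-|/setIidPr //].
    exact: subsetIl.
  by move=> A /setIidPr AS; rewrite setDDr setDv set0U.
case: (arg_maxnP (fun e => rk e.2 - rk e.1)%N e0E) => -[p r] eE maxE'.
have /and3P[/= pS rS Epr] : [&& p \in S, r \in S & E p r].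
  by have : (p, r) \in edges E S := eE; rewrite inE.
have maxE : {in S &, forall x y, E x y -> (rk y - rk x <= rk r - rk p)%N}.
  by move=> x y xS yS Exy; apply: (maxE' (x, y));
    rewrite -[is_true _]/(is_true (_ \in edges E S)) inE xS yS.
have pr : p != r.
  by apply: contraTneq (uiE.1 _ _ pS rS Epr) => ->; rewrite ltnn.
pose E1 := del_edge E p r; pose S' := (S :\ p) :\ r.
have uiE1 : unit_interval E1 S by apply: unit_interval_del_edge.
have S'S : S' \subset S by exact: subset_trans (subsetDl _ _) (subsetDl _ _).
have E1through : {in S', forall y, E1 p y = E1 y r}.
  by move=> y yS'; apply: edge_through uiE yS'.
have E1pr : ~~ E1 p r by rewrite /E1 /del_edge eqxx andbF.
have cardS : #|S| = (#|S'|.+2)%N.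
  by rewrite (cardsD1 p) pS (cardsD1 r (S :\ p)) !inE eq_sym pr rS.
have lt_edges : (#|edges E1 S| < #|edges E S|)%N.
  apply/proper_card/properP; split.
    by apply/subsetP => e; rewrite !inE => /and3P[-> -> /andP[->]].
  by exists (p, r); rewrite !inE /= pS rS //= (negPf E1pr).
have le_edges : (#|edges E1 S'| <= #|edges E1 S|)%N.
  apply/subset_leq_card/subsetP => e; rewrite inE => /and3P[].
  by move=> /(subsetP S'S) e1 /(subsetP S'S) e2 Ee; rewrite inE e1 e2.
(* The deleted edge gives a factor [t = 1 + (t - 1)] to the sets that contain [p] but not [r]; such
   sets correspond to the subsets of [S']. *)
have split_sum (f : {set T} -> R) :
  \sum_(A : {set T} | A \subset S) f A * t ^+ asc_in E S A =
  \sum_(A : {set T} | A \subset S) f A * t ^+ asc_in E1 S A +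
  (t - 1) * t ^+ (\sum_(y in S') E1 p y) *
    \sum_(A : {set T} | A \subset S') f (p |: A) * t ^+ asc_in E1 S' A.
  pose P A := (p \in A) && (r \notin A).
  transitivity (\sum_(A : {set T} | A \subset S) f A * t ^+ asc_in E1 S A +
    \sum_(A : {set T} | A \subset S)
       (if P A then (t - 1) * (f A * t ^+ asc_in E1 S A) else 0)).
    rewrite -big_split; apply: eq_bigr => A _ /=.
    rewrite (asc_in_del_edge A pS rS Epr) -/E1 -/(P A).
    by case: (P A); rewrite ?addr0 // exprS mulrCA mulrBl mul1r addrC subrK.
  congr (_ + _); rewrite -big_mkcondr big_distrr /=.
  rewrite (reindex_onto (fun A => p |: A) (fun A => A :\ p)) /=; last first.
    by move=> A /and3P[_ pA _]; rewrite setD1K.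
  rewrite big_mkcond [RHS]big_mkcond; apply: eq_bigr => A _ /=.
  have -> : ((p |: A \subset S) && P (p |: A) && ((p |: A) :\ p == A)) =
      (A \subset S').
    have -> : ((p |: A) :\ p == A) = (p \notin A).
      by apply/eqP/idP => [<-|/setU1K //]; rewrite !inE eqxx.
    rewrite /P setU11 subUset sub1set pS /= !subsetD1 !inE negb_or eq_sym pr /=.
    by rewrite -!andbA [(r \notin A) && _]andbC.
  case: ifP => // AS'; rewrite (asc_in_fixed pr pS rS E1pr) // exprD -/S' -!mulrA.
  by congr (_ * _); rewrite mulrCA.
rewrite !split_sum; congr (_ + _ * _).
  by apply: IHn => //; apply: leq_trans le_n; rewrite ltn_add2l.
pose g' m := g m.+1.
transitivity (\sum_(A : {set T} | A \subset S') g' #|A| * t ^+ asc_in E1 S' A).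
  apply: eq_bigr => A AS'; rewrite cardsU1 (_ : p \notin A) //.
  by apply/negP => /(subsetP AS'); rewrite !inE eqxx andbF.
rewrite IHn; last 2 first.
- by apply: leq_trans le_n; rewrite cardS; lia.
- exact: unit_intervalS S'S uiE1.
apply: eq_bigr => A AS'; congr (g _ * _).
have pAS : p |: A \subset S by rewrite subUset sub1set pS (subset_trans AS').
rewrite (cardsDS AS') (cardsDS pAS) cardsU1 (_ : p \notin A) ?cardS; last first.
  by apply/negP => /(subsetP AS'); rewrite !inE eqxx andbF.
by have := subset_leq_card AS'; lia.
Qed.

End TwoLetters.

(** * Unicellular LLT polynomials *)

Section Labellings.
Variables (T : finType) (E : rel T) (R : comNzRingType) (t : R).
Implicit Types (s : seq nat) (A : {set T}) (c : rel nat).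

Definition fiber N (f : {ffun T -> 'I_N}) (k : nat) : {set T} :=
  [set x | f x == k :> nat].

Definition has_content N s (f : {ffun T -> 'I_N}) :=
  [forall k : 'I_N, #|fiber f k| == nth 0%N s k].

Definition ascents c N (f : {ffun T -> 'I_N}) : nat :=
  (\sum_x \sum_y (E x y && c (f x) (f y)))%N.

(** For [c] the strict order and [N] at least the size of [s], this is the coefficient of [x^s] in
    the unicellular LLT polynomial of the graph. *)
Definition llt c N s : R :=
  \sum_(f : {ffun T -> 'I_N} | has_content s f) t ^+ ascents c f.

Lemma has_contentP N s (f : {ffun T -> 'I_N}) : (size s <= N)%N ->
  reflect (forall k, #|fiber f k| = nth 0%N s k) (has_content s f).
Proof.
move=> sN; apply: (iffP forallP) => [fs k|fs k]; last by rewrite fs.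
have [lt_kN|le_Nk] := ltnP k N; first exact/eqP/(fs (Ordinal lt_kN)).
rewrite nth_default ?(leq_trans sN) //; apply/eqP; rewrite cards_eq0.
by apply/eqP/setP => x; rewrite !inE ltn_eqF // (leq_trans _ le_Nk).
Qed.

Lemma has_content0 N k s (f : {ffun T -> 'I_N.+1}) :
  has_content (k :: s) f -> #|fiber f 0| = k.
Proof. by move=> /forallP/(_ ord0)/eqP. Qed.

(** * Splitting one letter into two consecutive letters *)

Section Split.
Variables (N : nat) (k : 'I_N.+1).
Implicit Types (f : {ffun T -> 'I_N.+1}).

(** [bump] makes room for one more letter: the cells of the fiber of [k] outside [A] move up to
    [k.+1]. *)
Definition split_label (fA : {ffun T -> 'I_N.+1} * {set T}) : {ffun T -> 'I_N.+2} :=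
  [ffun x => if x \in fA.2 then inord k else inord (bump k (fA.1 x))].

Definition merge_label (g : {ffun T -> 'I_N.+2}) : {ffun T -> 'I_N.+1} * {set T} :=
  ([ffun x => inord (unbump k (g x))], fiber g k).

Lemma split_labelE f A x :
  split_label (f, A) x = (if x \in A then val k else bump k (f x)) :> nat.
Proof.
have := ltn_ord k; have := ltn_ord (f x) => ? ?.
by rewrite ffunE /=; case: ifP => _; rewrite inordK // /bump; lia.
Qed.

Lemma fiber_split f A : A \subset fiber f k ->
  forall j, fiber (split_label (f, A)) j =
    if (j < k)%N then fiber f j else if j == k :> nat then A
    else if j == k.+1 then fiber f k :\: A else fiber f j.-1.
Proof.
move=> /subsetP sA j; apply/setP => x; rewrite inE split_labelE.
have := sA x; rewrite inE; have [xA /(_ isT) /eqP fx|xA _] := boolP (x \in A).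
  case: (ltngtP j k) => kj; rewrite ?xA ?inE ?fx; [lia| |by []].
  by case: (eqVneq j k.+1) => ej; rewrite !inE ?xA ?fx; lia.
rewrite /bump; case: (ltngtP j k) => kj; rewrite ?inE ?(negPf xA); [lia| |lia].
by case: (eqVneq j k.+1) => ej; rewrite !inE ?(negPf xA); lia.
Qed.

Lemma sum_split_label (V : nmodType) (F : {ffun T -> 'I_N.+2} -> V) :
  \sum_g F g = \sum_f \sum_(A : {set T} | A \subset fiber f k) F (split_label (f, A)).
Proof.
rewrite pair_big_dep /= (reindex_onto split_label merge_label) /=; last first.
  move=> g _; apply/ffunP => x; apply: val_inj.
  rewrite /merge_label /= split_labelE inE.
  case: eqP => [//|/eqP ne]; rewrite ffunE inordK.
    by rewrite unbumpKcond (negPf ne).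
  by have := ltn_ord (g x); have := ltn_ord k; rewrite /unbump; lia.
apply: eq_bigl => -[f A] /=; apply/eqP/idP => [[def_f def_A]|sA].
  apply/subsetP => x xA; rewrite inE -def_f ffunE split_labelE xA.
  by rewrite /unbump ltnn subn0 inord_val.
congr (_, _); last by rewrite fiber_split // ltnn eqxx.
apply/ffunP => x; apply: val_inj; rewrite ffunE split_labelE.
case: ifP => [/(subsetP sA)|_]; last by rewrite bumpK inord_val.
by rewrite inE => /eqP fx; rewrite /unbump ltnn subn0 inord_val; exact: esym.
Qed.

Lemma has_content_split f A s1 s2 a b : A \subset fiber f k ->
    size s1 = k -> (size s1 + size s2 <= N)%N ->
  has_content (s1 ++ a :: b :: s2) (split_label (f, A)) =
  [&& has_content (s1 ++ (a + b)%N :: s2) f, #|A| == a & #|fiber f k :\: A| == b].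
Proof.
move=> sA sz1 szN.
have nth1 j : nth 0%N (s1 ++ a :: b :: s2) j = if (j < k)%N then nth 0%N s1 j
    else if j == k :> nat then a else if j == k.+1 then b
    else nth 0%N s2 (j.-1 - k.+1).
  rewrite nth_cat sz1; case: ltngtP => kj //; last by rewrite -kj subnn.
  case: eqVneq => [->|ne]; first by rewrite subSn // subnn.
  by rewrite (_ : j - k = (j.-1 - k.+1).+2)%N //; lia.
have nth2 j : nth 0%N (s1 ++ (a + b)%N :: s2) j = if (j < k)%N then nth 0%N s1 j
    else if j == k :> nat then (a + b)%N else nth 0%N s2 (j - k.+1).
  rewrite nth_cat sz1; case: ltngtP => kj //; last by rewrite -kj subnn.
  by rewrite (_ : j - k = (j - k.+1).+1)%N //; lia.
have sz_ab : (size (s1 ++ a :: b :: s2) <= N.+2)%N by rewrite size_cat /=; lia.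
have sz_a_b : (size (s1 ++ (a + b)%N :: s2) <= N.+1)%N by rewrite size_cat /=; lia.
have fib := fiber_split sA; apply/(has_contentP _ sz_ab)/and3P => [fs|].
  have fA : #|A| = a by have := fs k; rewrite fib nth1 ltnn eqxx.
  have fB : #|fiber f k :\: A| = b.
    by have := fs k.+1; rewrite fib nth1 ltnNge leqnSn /= gtn_eqF // eqxx.
  split; rewrite ?fA ?fB //; apply/(has_contentP _ sz_a_b) => j.
  rewrite nth2; case: (ltngtP j k) => [lt_jk|lt_kj|->].
  - by have := fs j; rewrite fib nth1 lt_jk.
  - have := fs j.+1; rewrite fib nth1 ltnNge ltnW 1?ltnW //=.
    by rewrite !gtn_eqF // ?ltnS // ltnW.
  - by rewrite -fA -fB cardsDS // subnKC // subset_leq_card.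
case=> /(has_contentP _ sz_a_b) fs /eqP fA /eqP fB j; rewrite fib nth1.
case: (ltngtP j k) => [lt_jk|lt_kj|//]; first by rewrite fs nth2 lt_jk.
case: eqVneq => // ne; rewrite fs nth2.
have ltj : (k < j.-1)%N by lia.
by rewrite ltnNge ltnW // gtn_eqF.
Qed.

Lemma llt_split c s1 s2 a b : size s1 = k -> (size s1 + size s2 <= N)%N ->
  llt c N.+2 (s1 ++ a :: b :: s2) =
  \sum_(f : {ffun T -> 'I_N.+1} | has_content (s1 ++ (a + b)%N :: s2) f)
    \sum_(A : {set T} | A \subset fiber f k)
      ((#|A| == a) && (#|fiber f k :\: A| == b))%:R *
      t ^+ ascents c (split_label (f, A)).
Proof.
move=> sz1 szN; rewrite /llt big_mkcond sum_split_label [RHS]big_mkcond /=.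
apply: eq_bigr => f _.
under eq_bigr => A sA do rewrite has_content_split //.
case: ifP => _ /=; last by rewrite big1.
by apply: eq_bigr => A _; case: ifP; rewrite ?mul1r ?mul0r.
Qed.

(** Comparisons between different letters are unchanged, so new ascents arise only inside the fiber,
    along the edges from [A] to its complement. *)
Lemma ascents_split f A : A \subset fiber f k ->
  ascents ltn (split_label (f, A)) = (ascents ltn f + asc_in E (fiber f k) A)%N.
Proof.
move=> /subsetP sA; rewrite /ascents /asc_in.
rewrite [X in (_ + X)%N]big_mkcond -big_split /=; apply: eq_bigr => x _.
under eq_bigr do rewrite !split_labelE.
transitivity (\sum_y (E x y && (f x < f y) +
    [&& x \in fiber f k, y \in fiber f k, x \in A, y \notin A & E x y]))%N.
  apply: eq_bigr => y _.
  have hA z : z \in A -> f z = k :> nat by move=> /sA; rewrite inE => /eqP.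
  rewrite !inE; case: (E x y); last by rewrite !andbF.
  case: (boolP (x \in A)) => [/hA fx|_]; case: (boolP (y \in A)) => [/hA fy|_].
  - by rewrite /= ?andbF fx fy !ltnn.
  - by rewrite /= /bump fx eqxx; lia.
  - by rewrite /= /bump ?andbF fy; lia.
  - by rewrite /= /bump ?andbF; lia.
rewrite big_split /=; congr (_ + _)%N; case: ifP => xS; last by rewrite big1.
by rewrite [RHS]big_mkcond; apply: eq_bigr => y _ /=; case: (y \in _).
Qed.

End Split.

(* The label [0] is starred: equal starred labels count as an ascent. *)
Definition star_lt : rel nat := fun a b => (a < b)%N || (a == 0%N) && (b == 0%N).

Definition out_deg (S : {set T}) x : nat := (\sum_(y in S) E x y)%N.

Lemma ascents_star N (f : {ffun T -> 'I_N}) :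
  ascents star_lt f =
  (ascents ltn f + \sum_(x in fiber f 0) out_deg (fiber f 0) x)%N.
Proof.
rewrite /ascents /out_deg [X in (_ + X)%N]big_mkcond -big_split /=.
apply: eq_bigr => x _; rewrite inE.
transitivity (\sum_y (E x y && (f x < f y) +
    [&& f x == 0 :> nat, f y == 0 :> nat & E x y]))%N.
  apply: eq_bigr => y _; rewrite /star_lt; case: (E x y); last by rewrite !andbF.
  by lia.
rewrite big_split /=; congr (_ + _)%N; case: ifP => xS; last by rewrite big1.
by rewrite [RHS]big_mkcond; apply: eq_bigr => y _ /=; rewrite inE; case: eqP.
Qed.

(** Inside the fiber, an edge out of [A] leads to [A] (two equal starred letters) or to the rest (a
    starred letter and a larger one); it counts in both cases. *)
Lemma ascents_star_split N (f : {ffun T -> 'I_N.+1}) A : A \subset fiber f 0 ->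
  ascents star_lt (split_label ord0 (f, A)) =
  (ascents ltn f + \sum_(x in A) out_deg (fiber f 0) x)%N.
Proof.
move=> sA; rewrite ascents_star ascents_split // fiber_split //= -addnA.
congr (_ + _)%N; rewrite /asc_in /out_deg.
rewrite (bigID (mem A)) /= [X in (_ + X + _)%N]big1 ?addn0; last first.
  by move=> x /andP[_ /negPf xA]; rewrite big1 // => y _; rewrite xA.
rewrite (eq_bigl (mem A)); last first.
  by move=> x /=; apply: andb_idl => /(subsetP sA).
rewrite -big_split /=; apply: eq_bigr => x xA; rewrite xA /=.
rewrite [RHS](bigID (mem A)) /= addnC; congr (_ + _)%N.
  by apply: eq_bigl => y; rewrite andb_idl // => /(subsetP sA).
by rewrite big_mkcondr; apply: eq_bigr => y _ /=; case: (y \in A).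
Qed.

Lemma prod_subset (S : {set T}) (F G : T -> R) :
  \sum_(A : {set T} | A \subset S) (\prod_(x in A) F x) * \prod_(x in S :\: A) G x =
  \prod_(x in S) (F x + G x).
Proof.
rewrite [RHS]big_mkcond /=.
transitivity (\prod_x ((if x \in S then F x else 0) + (if x \in S then G x else 1))).
  rewrite bigA_distr big_mkcond; apply: eq_bigr => A _ /=; case: ifPn => sA.
    rewrite [RHS](bigID (mem A)) /=; congr (_ * _).
      by apply: eq_bigr => x xA; rewrite xA (subsetP sA).
    rewrite [in RHS]big_mkcond /= [LHS]big_mkcond; apply: eq_bigr => x _ /=.
    by rewrite !inE; case: (x \in A); case: (x \in S).
  have /subsetPn[x xA xS] := sA.
  by rewrite (bigD1 x) //= xA (negPf xS) mul0r.
by apply: eq_bigr => x _; case: ifP; rewrite ?add0r.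
Qed.

(** The expected pairing of the LLT polynomial with [e_ k] times the product of the [h_ i] for [i]
    in [s]. *)
Definition star_llt k (s : seq nat) : R := llt star_lt (size s).+1 (k :: s).

Lemma llt_split_star k i s : star_llt k (i :: s) =
  \sum_(f : {ffun T -> 'I_(size s).+1} | has_content ((k + i)%N :: s) f)
    \sum_(A : {set T} | A \subset fiber f 0)
      ((#|A| == k) && (#|fiber f 0 :\: A| == i))%:R *
      t ^+ (ascents ltn f + \sum_(x in A) out_deg (fiber f 0) x).
Proof.
rewrite /star_llt (@llt_split _ ord0 _ [::]) //=; apply: eq_bigr => f _.
by apply: eq_bigr => A sA; rewrite ascents_star_split.
Qed.

Lemma star_llt0 k s : star_llt k (0%N :: s) = star_llt k s.
Proof.
rewrite llt_split_star addn0; apply: eq_bigr => f fs.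
have cardS : #|fiber f 0| = k by exact: has_content0 fs.
rewrite (bigD1 (fiber f 0)) //= setDv cards0 cardS !eqxx mul1r ascents_star.
rewrite [X in _ + X]big1 ?addr0 // => A /andP[sA ne].
rewrite cards_eq0 setD_eq0; case: (boolP (_ \subset A)) => [sS|]; last first.
  by rewrite andbF mul0r.
by case/eqP: ne; apply/eqP; rewrite eqEsubset sA.
Qed.

(** Merging the starred letter with the next one leaves a fiber of [k.+1] cells, over which the
    signed sum is a product of factors [t ^ out_deg - 1]. The factor at a cell of maximal rank
    vanishes, since no edge leaves it inside the fiber. *)
Lemma sum_star_llt (rk : T -> nat) k s :
    (forall x y, E x y -> (rk x < rk y)%N) ->
  \sum_(i < k.+2) (-1) ^+ i *
    star_llt (k.+1 - i) (if val i is 0 then s else val i :: s) = 0.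
Proof.
move=> rkE.
transitivity (\sum_(i < k.+2) (-1) ^+ i * star_llt (k.+1 - i) (val i :: s)).
  by apply: eq_bigr => -[[|i] lt_i] //= _; rewrite star_llt0.
transitivity (\sum_(f : {ffun T -> 'I_(size s).+1} | has_content (k.+1 :: s) f)
    t ^+ ascents ltn f * \sum_(A : {set T} | A \subset fiber f 0)
    (\prod_(x in A) t ^+ out_deg (fiber f 0) x) * \prod_(x in fiber f 0 :\: A) (-1)).
  under eq_bigr => i _ do rewrite llt_split_star subnK -1?ltnS // big_distrr /=.
  rewrite exchange_big; apply: eq_bigr => f fs /=.
  have cardS : #|fiber f 0| = k.+1 by exact: has_content0 fs.
  under eq_bigr => i _ do rewrite big_distrr /=.
  rewrite exchange_big big_distrr; apply: eq_bigr => A sA /=.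
  (* For a given [A], only the index [i] equal to the size of its complement contributes. *)
  have lt_i : (#|fiber f 0 :\: A| < k.+2)%N.
    by rewrite ltnS -cardS subset_leq_card ?subsetDl.
  rewrite (bigD1 (Ordinal lt_i)) //= [X in _ + X]big1 ?addr0 => [|i ne].
    rewrite eqxx andbT cardsDS // cardS subKn ?eqxx; last first.
      by rewrite -cardS subset_leq_card.
    rewrite mul1r exprD expr_sum prodr_const mulrCA [_ * (-1) ^+ _]mulrC.
    by rewrite cardsDS // cardS.
  have [ei|_] := eqVneq #|fiber f 0 :\: A| i; last by rewrite andbF mul0r mulr0.
  by case/eqP: ne; apply: val_inj.
rewrite big1 // => f fs; rewrite prod_subset.
have cardS : #|fiber f 0| = k.+1 by exact: has_content0 fs.
have [x0 x0S] : exists x0, x0 \in fiber f 0 by apply/card_gt0P; rewrite cardS.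
case: (arg_maxnP rk x0S) => x xS maxx.
have out0 : out_deg (fiber f 0) x = 0%N.
  rewrite /out_deg big1 // => y yS.
  apply/eqP; rewrite eqb0; apply/negP => /rkE; rewrite ltnNge => /negP; apply.
  exact: maxx.
by rewrite (bigD1 x) //= out0 expr0 subrr mul0r mulr0.
Qed.

(** Merging the two letters leaves the constant labelling, so the left side sums over the sets of
    [n - d] starred cells. On the right, these cells choose the power of [t], and the other [d]
    choose ['X]. *)
Lemma star_llt_hook n d : #|T| = n -> (d <= n)%N ->
  star_llt (n - d) [:: d] =
  (\prod_x ((t ^+ out_deg setT x)%:P + 'X))`_d.
Proof.
move=> cardT le_dn; rewrite llt_split_star /= subnK //.
pose f0 : {ffun T -> 'I_1} := [ffun=> ord0].
have fib0 (f : {ffun T -> 'I_1}) : fiber f 0 = setT.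
  by apply/setP => x; rewrite !inE (ord1 (f x)).
rewrite (big_pred1 f0) => [|f]; last first.
  have -> : f = f0 by apply/ffunP => x; rewrite !(ord1 (_ x)).
  transitivity true; last by rewrite /= eqxx.
  by apply/forallP => j; rewrite (ord1 j) fib0 cardsT cardT.
have -> : ascents ltn f0 = 0%N.
  by rewrite /ascents big1 // => x _; rewrite big1 // => y _; rewrite !ffunE andbF.
rewrite fib0 bigA_distr coef_sum [LHS]big_mkcond; apply: eq_bigr => A _ /=.
rewrite subsetT add0n expr_sum.
have -> : \prod_x (if x \in A then (t ^+ out_deg setT x)%:P else 'X) =
    (\prod_(x in A) t ^+ out_deg setT x)%:P * 'X^#|~: A|.
  rewrite (bigID (mem A)) /=; congr (_ * _).
    by rewrite rmorph_prod; apply: eq_bigr => x ->.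
  rewrite -prodr_const; apply: eq_big => x; first by rewrite inE.
  by move/negPf ->.
rewrite coefCM coefXn mulrC; congr (_ * _%:R); rewrite setTD.
have := cardsC A; rewrite cardT => cardA.
by congr nat_of_bool; lia.
Qed.

(** * Symmetry of the LLT polynomial in its letters *)

Section Symmetry.
Variable rk : T -> nat.
Hypothesis rk_inj : injective rk.
Hypothesis uiE : unit_interval rk E setT.

(** Merging the two letters reduces the claim to a single fiber, where [two_letter_symmetry] applies
    to the indicator of the prescribed sizes. *)
Lemma llt_swap s1 s2 a b :
  llt ltn (size s1 + size s2).+2 (s1 ++ a :: b :: s2) =
  llt ltn (size s1 + size s2).+2 (s1 ++ b :: a :: s2).
Proof.
have lt_k : (size s1 < (size s1 + size s2).+1)%N by rewrite ltnS leq_addr.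
pose k := Ordinal lt_k; rewrite !(@llt_split _ k) // [(b + a)%N]addnC.
apply: eq_bigr => f _; set S := fiber f k.
have uiS : unit_interval rk E S by apply: unit_intervalS uiE; exact: subsetT.
pose g m : R := ((m == a) && (#|S| - m == b)%N)%:R.
transitivity (t ^+ ascents ltn f *
    \sum_(A : {set T} | A \subset S) g #|A| * t ^+ asc_in E S A).
  rewrite big_distrr; apply: eq_bigr => A sA /=.
  by rewrite ascents_split // exprD mulrCA /g cardsDS.
rewrite (two_letter_symmetry t rk_inj g uiS) big_distrr; apply: eq_bigr => A sA /=.
rewrite ascents_split // exprD mulrCA /g cardsDS // andbC.
by rewrite subKn ?subset_leq_card // mulrA [_ * g _]mulrC.
Qed.

Lemma perm_invariant (V : Type) (F : seq nat -> V) :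
    (forall s1 s2 a b, F (s1 ++ a :: b :: s2) = F (s1 ++ b :: a :: s2)) ->
  forall s s', perm_eq s s' -> F s = F s'.
Proof.
move=> F_swap s s' ss'.
have move_head s1 pre a s2 : F (pre ++ a :: s1 ++ s2) = F (pre ++ s1 ++ a :: s2).
  elim: s1 pre => //= b s1 IH pre.
  by rewrite F_swap -cat_rcons IH cat_rcons.
suff : forall pre, F (pre ++ s) = F (pre ++ s') by move=> /(_ [::]).
elim: s s' ss' => [|a s IH] s' ss' pre.
  by move: ss'; rewrite perm_sym => /perm_nilP ->.
have as' : a \in s' by rewrite -(perm_mem ss') mem_head.
case/splitPr: as' ss' => s1 s2; rewrite -move_head.
rewrite (permPr (permEl (perm_catCA s1 [:: a] s2))) /= perm_cons => ss'.
by rewrite -!cat_rcons; apply: IH.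
Qed.

Lemma llt_perm s s' : perm_eq s s' -> llt ltn (size s) s = llt ltn (size s') s'.
Proof.
apply: (perm_invariant (F := fun s => llt ltn (size s) s)) => s1 s2 a b.
by rewrite !size_cat /= !addnS llt_swap.
Qed.

Lemma llt_drop0 s a :
  llt ltn (size s).+2 (s ++ [:: a; 0%N]) = llt ltn (size s).+1 (s ++ [:: a]).
Proof.
have lt_k : (size s < (size s).+1)%N by [].
rewrite (@llt_split _ (Ordinal lt_k)) ?addn0 //; apply: eq_bigr => f fs.
set S := fiber _ _.
have cardS : #|S| = a.
  have sz : (size (s ++ [:: a]) <= (size s).+1)%N by rewrite size_cat addn1.
  by have := has_contentP _ sz fs (size s); rewrite nth_cat ltnn subnn.
rewrite (bigD1 S) //= setDv cards0 cardS !eqxx mul1r ascents_split // -/S.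
rewrite (_ : asc_in E S S = 0%N) ?addn0; last first.
  by rewrite /asc_in big1 // => x xS; rewrite big1 // => y ->; rewrite andbF.
rewrite [X in _ + X]big1 ?addr0 // => A /andP[sA ne].
rewrite cards_eq0 setD_eq0; case: (boolP (_ \subset A)) => [sS|]; last first.
  by rewrite andbF mul0r.
by case/eqP: ne; apply/eqP; rewrite eqEsubset sA.
Qed.

Lemma llt_zeros s z :
  llt ltn (size s + z.+1) (s ++ nseq z.+1 0%N) = llt ltn (size s).+1 s.
Proof.
elim: z => [|z <-]; rewrite ?addn1.
  apply: eq_bigl => f; apply: eq_forallb => j; rewrite nth_cat.
  by case: ltnP => // le_j; rewrite [in RHS]nth_default //=; case: (_ - _)%N => [|[]].
have -> : s ++ nseq z.+2 0%N = (s ++ nseq z 0%N) ++ [:: 0%N; 0%N].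
  by rewrite -catA -[z.+2]addn2 nseqD.
have -> : s ++ nseq z.+1 0%N = (s ++ nseq z 0%N) ++ [:: 0%N].
  by rewrite -catA -[z.+1]addn1 nseqD.
by have := llt_drop0 (s ++ nseq z 0%N) 0; rewrite size_cat size_nseq !addnS.
Qed.

Lemma star_llt_base s s' : perm_eq s' [seq n <- s | n != 0%N] ->
  star_llt 0 s = llt ltn (size s').+1 s'.
Proof.
move=> ss'; rewrite -(llt_zeros s' (count_mem 0%N s)).
have perm_s : perm_eq (0%N :: s) (s' ++ nseq (count_mem 0%N s).+1 0%N).
  have perm_s0 : perm_eq s ([seq n <- s | n != 0%N] ++ nseq (count_mem 0%N s) 0%N).
    rewrite perm_sym -(permPr (permEl (perm_filterC (fun n => n != 0%N) s))).
    rewrite perm_cat2l (_ : nseq _ _ = [seq n <- s | predC (fun n => n != 0%N) n]) //.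
    by elim: s {ss'} => //= -[|n] s <-.
  rewrite perm_sym (permPl (permEl (perm_catCA s' [:: 0%N] _))) /= perm_cons.
  by rewrite perm_sym (permPl perm_s0) perm_cat // perm_sym.
have := llt_perm perm_s; rewrite size_cat size_nseq => <-.
rewrite /star_llt; apply: eq_bigr => f fs; rewrite ascents_star big1 ?addn0 // => x.
by rewrite (cards0_eq (has_content0 fs)) inE.
Qed.

End Symmetry.
End Labellings.

From mathcomp Require Import finmap multiset.
From mathcomp Require Import boolp classical_sets functions cardinality fsbigop.
Local Open Scope mset_scope.
Local Open Scope classical_set_scope.
Local Open Scope ring_scope.

(** * The complete homogeneous expansion *)

Section FpsCoef.
Variables (I : choiceType) (R : comNzRingType).
Implicit Types (f g : fps I R) (m : {mset I}) (P : pred I).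

Lemma coef_fpsM f g m :
  (f * g)@_[m] = \sum_(p <- factor_seq m) f@_[p.1] * g@_[p.2].
Proof. exact: fps_mulE. Qed.

Lemma coef_fpsD f g m : (f + g)@_[m] = f@_[m] + g@_[m].
Proof. by []. Qed.

Lemma coef_fpsN f m : (- f)@_[m] = - f@_[m].
Proof. by []. Qed.

Lemma coef_fpsZ (c : R) f m : (c *: f)@_[m] = c * f@_[m].
Proof. by []. Qed.

Lemma coef_fps_sum (J : Type) (s : seq J) (P : pred J) (F : J -> fps I R) m :
  (\sum_(j <- s | P j) F j)@_[m] = \sum_(j <- s | P j) (F j)@_[m].
Proof. by apply: (big_morph (fun f => f@_[m])). Qed.

Lemma fps_scalerAl (c : R) f g : c *: (f * g) = c *: f * g.
Proof.
apply/fpsP => m; rewrite coef_fpsZ !coef_fpsM big_distrr /=.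
by apply: eq_bigr => p _; rewrite mulrA.
Qed.

(** The specialization that sets the variables outside [P] to zero. *)
Definition kill P f : fps I R := Fps (fun m => if all P m then f@_[m] else 0).

Lemma coef_kill P f m : (kill P f)@_[m] = if all P m then f@_[m] else 0.
Proof. by []. Qed.

Lemma all_msetD P (m1 m2 : {mset I}) :
  all P (m1 `+` m2)%mset = all P m1 && all P m2.
Proof.
apply/allP/andP => [Pm|[/allP Pm1 /allP Pm2] x].
  by split; apply/allP => x xm; apply: Pm; rewrite in_msetD xm ?orbT.
by rewrite in_msetD => /orP[/Pm1|/Pm2].
Qed.

Lemma kill1 P : kill P 1 = 1.
Proof.
apply/fpsP => m; rewrite coef_kill coef_fps1.
by case: (m =P mset0) => [->|_]; [rewrite enum_mset0 | case: ifP].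
Qed.

Lemma killM P f g : kill P (f * g) = kill P f * kill P g.
Proof.
apply/fpsP => m; rewrite coef_kill !coef_fpsM.
case: ifP => Pm.
  apply: eq_big_seq => p; rewrite mem_factor_seq => /eqP pm.
  by move: Pm; rewrite -pm all_msetD => /andP[P1 P2]; rewrite !coef_kill P1 P2.
rewrite big_seq big1 // => p; rewrite mem_factor_seq => /eqP pm.
move: Pm; rewrite -pm all_msetD !coef_kill; case: (all P _) => /=.
  by move=> ->; rewrite mulr0.
by rewrite mul0r.
Qed.

Lemma killD P f g : kill P (f + g) = kill P f + kill P g.
Proof.
by apply/fpsP => m; rewrite coef_fpsD !coef_kill; case: ifP; rewrite ?addr0.
Qed.

Lemma kill0 P : kill P 0 = 0.
Proof. by apply/fpsP => m; rewrite coef_kill; case: ifP. Qed.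

Lemma killZ P (c : R) f : kill P (c *: f) = c *: kill P f.
Proof.
by apply/fpsP => m; rewrite coef_fpsZ !coef_kill; case: ifP; rewrite ?mulr0.
Qed.

Lemma killN P f : kill P (- f) = - kill P f.
Proof.
by apply/fpsP => m; rewrite coef_fpsN !coef_kill; case: ifP; rewrite ?oppr0.
Qed.

Lemma kill_sign P k f : kill P ((-1) ^+ k * f) = (-1) ^+ k * kill P f.
Proof. by rewrite -signr_odd !mulr_sign; case: odd; rewrite ?killN. Qed.

Lemma kill_sum (J : Type) (s : seq J) (Q : pred J) P (F : J -> fps I R) :
  kill P (\sum_(j <- s | Q j) F j) = \sum_(j <- s | Q j) kill P (F j).
Proof. by apply: (big_morph (kill P)); [exact: killD | exact: kill0]. Qed.

Lemma kill_prod (J : Type) (s : seq J) (Q : pred J) P (F : J -> fps I R) :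
  kill P (\prod_(j <- s | Q j) F j) = \prod_(j <- s | Q j) kill P (F j).
Proof. by apply: (big_morph (kill P)); [exact: killM | exact: kill1]. Qed.

Lemma fpsX_inj (i : I) f : fpsX i * f = 0 -> f = 0.
Proof.
move=> /fpsP Xf0; apply/fpsP => m.
move: (Xf0 ([mset i] `+` m)%mset); rewrite coef_fpsXM in_msetD in_mset1 eqxx /=.
suff -> : (([mset i] `+` m) `\ i)%mset = m by [].
by apply/msetP => x; rewrite !msetE2 addKn.
Qed.

End FpsCoef.

Lemma fresh_nat (m : {mset nat}) : exists j, j \notin m.
Proof.
have ubm j : j \in m -> (j <= \sum_(i <- m) i)%N.
  by move=> jm; rewrite (big_rem j) ?leq_addr.
exists (\sum_(i <- m) i).+1; apply/negP => /ubm.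
by rewrite ltnn.
Qed.

(* A symmetric function is free over the powers of a single variable, because
   the variable can be chosen outside of any given monomial. *)
Lemma poly_fpsX_roots (R : comNzRingType) (Q : {poly fps nat R}) :
  (forall j, Q.[- fpsX j] = 0) -> Q = 0.
Proof.
elim/poly_ind: Q => // p c IHp Q0.
have c0 : c = 0.
  apply/fpsP => m; have [j jm] := fresh_nat m.
  have /fpsP/(_ m) := Q0 j; rewrite hornerMXaddC mulrN mulrC coef_fpsD coef_fpsN.
  by rewrite coef_fpsXM (negPf jm) oppr0 add0r.
rewrite c0 addr0 IHp ?mul0r // => j.
have := Q0 j; rewrite c0 hornerMXaddC addr0 mulrN => /eqP.
by rewrite oppr_eq0 mulrC => /eqP /fpsX_inj.
Qed.

Lemma perm_msetB1 (I : choiceType) (m : {mset I}) j :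
  j \in m -> perm_eq m (j :: (m `\ j)%mset).
Proof.
move=> jm; apply/allP => x _ /=; rewrite !count_mem_mset msetB1E [j == x]eq_sym.
have [->|_] := eqVneq x j; last by rewrite subn0.
by rewrite add1n subn1 prednK ?mset_gt0.
Qed.

Lemma mulrBCA (R : comNzRingType) (a b c x y : R) :
  a * (b * (c - x * y)) = a * (b * c) - x * (a * (b * y)).
Proof. by rewrite !mulrBr [b * (x * y)]mulrCA [a * (x * _)]mulrCA. Qed.

Lemma mulrDCA (R : comNzRingType) (a b c x y : R) :
  a * ((b + x * y) * c) = a * (b * c) + x * (a * (y * c)).
Proof. by rewrite mulrDl mulrDr -mulrA [x * (a * _)]mulrCA. Qed.

(** * Products of complete homogeneous functions and the Hall pairing *)

Section HallExpansions.
Implicit Types (lam beta : seq nat) (m : {mset nat}).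

Lemma coef_e k m : (e_ k)@_[m] = (uniq (m : seq nat) && (size m == k))%:R.
Proof. by []. Qed.

Lemma coef_h k m : (h_ k)@_[m] = (size m == k)%:R.
Proof. by []. Qed.

Lemma h_0 : h_ 0 = 1.
Proof. by apply/fpsP => m; rewrite coef_h coef_fps1 size_mset_eq0. Qed.

Lemma e_0 : e_ 0 = 1.
Proof.
apply/fpsP => m; rewrite coef_e coef_fps1 size_mset_eq0.
by case: eqP => [->|]; rewrite ?enum_mset0 ?andbF.
Qed.

Lemma all_predC1 (I : eqType) (s : seq I) j : all (predC1 j) s = (j \notin s).
Proof. by elim: s => //= x s ->; rewrite inE negb_or eq_sym. Qed.

(* [h_(n-1)], with [h_(-1) = 0]. *)
Definition h_pred n : xseries := if n is n'.+1 then h_ n' else 0.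

(** The generating series of the [h_ n] in [z] has the factor [1 / (1 - x_j z)], so setting [x_j] to
    zero multiplies it by [1 - x_j z]. *)
Lemma kill_h j n : kill (predC1 j) (h_ n) = h_ n - fpsX j * h_pred n.
Proof.
apply/fpsP => m; rewrite coef_fpsD coef_fpsN coef_fpsXM coef_kill all_predC1.
case: ifPn => [/negPf ->|/negPn jm]; first by rewrite subr0.
rewrite jm coef_h (perm_size (perm_msetB1 jm)) /=.
by case: n => [|n] /=; rewrite ?subr0 // eqSS subrr.
Qed.

Definition e_pred n : xseries := if n is n'.+1 then e_ n' else 0.

Lemma e_kill j n :
  e_ n = kill (predC1 j) (e_ n) + fpsX j * kill (predC1 j) (e_pred n).
Proof.
apply/fpsP => m; rewrite coef_fpsD coef_fpsXM !coef_kill !all_predC1.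
case: ifPn => [/negPf ->|/negPn jm]; first by rewrite addr0.
rewrite jm add0r coef_e (perm_size (perm_msetB1 jm)) /=.
rewrite (perm_uniq (perm_msetB1 jm)) /=.
by case: n => [|n] /=; case: ifP; rewrite ?andbF //= ?coef_e ?eqSS.
Qed.

(** Setting any single variable to zero does not change the sum, so only its constant term can
    survive, and that vanishes for positive [k]. *)
Lemma sum_eh k : (0 < k)%N ->
  \sum_(i < k.+1) (-1) ^+ i * (e_ i * h_ (k - i)) = 0 :> xseries.
Proof.
case: k => // k _; set U := LHS.
have killU j : kill (predC1 j) U = U.
  rewrite /U kill_sum; pose K := kill (predC1 j) : xseries -> xseries.
  pose A := \sum_(i < k.+2) (-1) ^+ i * (K (e_ i) * h_ (k.+1 - i)).
  pose B := \sum_(i < k.+1) (-1) ^+ i * (K (e_ i) * h_ (k - i)).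
  (* Both sides equal [A - x_j B]: one by expanding the killed [h_], the other by expanding the [e_]
     and shifting the index. *)
  transitivity (A - fpsX j * B).
    transitivity (A - fpsX j *
        \sum_(i < k.+2) (-1) ^+ i * (K (e_ i) * h_pred (k.+1 - i))).
      rewrite big_distrr -sumrB /=; apply: eq_bigr => i _.
      by rewrite kill_sign killM kill_h mulrBCA.
    rewrite big_ord_recr /= subnn !mulr0 addr0; congr (_ - _ * _).
    by apply: eq_bigr => i _; rewrite subSn // -ltnS.
  apply/esym; transitivity (A + fpsX j *
      \sum_(i < k.+2) (-1) ^+ i * (K (e_pred i) * h_ (k.+1 - i))).
    rewrite big_distrr -big_split /=; apply: eq_bigr => i _.
    by rewrite {1}(e_kill j) mulrDCA.
  congr (_ + _); rewrite -mulrN; congr (_ * _).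
  rewrite big_ord_recl /= /K kill0 mul0r mulr0 add0r -sumrN.
  by apply: eq_bigr => i _; rewrite exprS mulN1r mulNr.
have /fpsP U0 : kill pred0 U = 0.
  rewrite kill_sum big1 // => i _; rewrite kill_sign killM.
  suff [->|->] : kill pred0 (e_ i) = 0 \/ kill pred0 (h_ (k.+1 - i)) = 0.
  - by rewrite mul0r mulr0.
  - by rewrite !mulr0.
  have all0 m : all pred0 m -> m = mset0.
    by rewrite all_pred0 => /eqP; move/eqP; rewrite size_mset_eq0 => /eqP.
  case: (posnP i) => [->|i0]; [right|left]; apply/fpsP => m; rewrite coef_kill.
    by case: ifP => // /all0 ->; rewrite coef_h size_mset0.
  by case: ifP => // /all0 ->; rewrite coef_e size_mset0 eq_sym eqn0Ngt i0 andbF.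
apply/fpsP => m; have [->|m0] := eqVneq m mset0.
  by have := U0 mset0; rewrite coef_kill enum_mset0.
have jm : nth 0%N m 0 \in m by rewrite mem_nth // lt0n size_mset_eq0.
by rewrite -(killU (nth 0%N m 0)) coef_kill all_predC1 jm.
Qed.

Lemma sum_he k : (0 < k)%N ->
  \sum_(i < k.+1) (-1) ^+ i * (e_ (k - i) * h_ i) = 0 :> xseries.
Proof.
move=> k0; rewrite (reindex_inj rev_ord_inj) /=.
rewrite -[RHS](mulr0 ((-1) ^+ k)) -[in RHS](sum_eh k0) big_distrr.
apply: eq_bigr => i _ /=; have le_ik : (i <= k)%N by rewrite -ltnS.
by rewrite subSS subKn // mulrA -exprD -signr_odd oddB // -oddD signr_odd.
Qed.

Lemma h_part_perm lam beta : perm_eq lam beta -> h_part lam = h_part beta.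
Proof. exact: perm_big. Qed.

(* Removes the first column of the Young diagram. *)
Definition strip lam := [seq n <- map predn lam | n != 0%N].

Lemma h_part_filter lam : h_part [seq n <- lam | n != 0%N] = h_part lam.
Proof.
rewrite /h_part big_filter [RHS](bigID (fun n => n != 0%N)) /= [X in _ * X]big1.
  by rewrite mulr1.
by move=> i /negPn /eqP ->; rewrite h_0.
Qed.

(** Its value at [- x_j] is [h_part lam] with [x_j] set to zero, and its coefficient of degree
    [size lam] is [h_part (strip lam)] when all parts are positive. *)
Definition h_shift lam : {poly xseries} :=
  \prod_(n <- lam) ((h_pred n) *: 'X + (h_ n)%:P).

Lemma size_h_shift lam : (size (h_shift lam) <= (size lam).+1)%N.
Proof.
rewrite /h_shift; elim: lam => [|n lam IH]; first by rewrite big_nil size_poly1.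
rewrite big_cons (leq_trans (size_polyMleq _ _)) //.
have : (size ((h_pred n *: 'X + (h_ n)%:P)%R) <= 2)%N.
  rewrite (leq_trans (size_polyD _ _)) // geq_max size_polyC.
  rewrite (leq_trans (size_scale_leq _ _)) ?size_polyX //.
  by case: (_ != 0).
move=> sz2; rewrite -subn1 leq_subLR (leq_trans (leq_add sz2 IH)) //=.
Qed.

Lemma coef_h_shift lam : 0%N \notin lam ->
  (h_shift lam)`_(size lam) = h_part (strip lam).
Proof.
rewrite h_part_filter /h_shift /h_part big_map.
elim: lam => [|n lam IH]; first by rewrite !big_nil coefC.
rewrite inE negb_or => /andP[n0 lam0]; rewrite !big_cons mulrDl coefD coefCM.
rewrite -[X in _ + _ * X]/((h_shift lam)`_(size lam).+1).
rewrite [X in _ + _ * X]nth_default ?size_h_shift // mulr0 addr0.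
by rewrite -scalerAl coefZ coefXM IH //=; case: n n0.
Qed.

Lemma horner_h_shift lam j :
  (h_shift lam).[- fpsX j] = kill (predC1 j) (h_part lam).
Proof.
rewrite /h_shift horner_prod kill_prod; apply: eq_bigr => n _.
by rewrite hornerD hornerZ hornerX hornerC kill_h mulrN mulrC addrC.
Qed.

Lemma strip_part lam : is_part lam -> is_part (strip lam).
Proof.
move=> /andP[lam_sorted lam0]; apply/andP; split.
  apply: sorted_filter; first by move=> x y z /= yx xz; apply: leq_trans xz yx.
  apply: (homo_sorted _ _ lam_sorted) => x y /=.
  by rewrite -!subn1 => ?; rewrite leq_sub2r.
by rewrite mem_filter eqxx.
Qed.

(** Inverts [strip] once the number [l] of parts is known. *)
Definition unstrip l lam := map S (lam ++ nseq (l - size lam) 0%N).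

Lemma stripK lam : is_part lam -> unstrip (size lam) (strip lam) = lam.
Proof.
move=> /andP[+ lam0]; rewrite /unstrip => lam_sorted.
have -> : strip lam ++ nseq (size lam - size (strip lam)) 0%N = map predn lam.
  elim: lam lam_sorted lam0 => // n lam IH lam_sorted.
  rewrite inE negb_or eq_sym /strip /= => /andP[n0 lam0].
  have {}IH := IH (path_sorted lam_sorted) lam0.
  case: eqP => /= [n1|_]; last by rewrite subSS IH.
  have lam1 : all (fun x => x.-1 == 0%N) lam.
    move: lam_sorted; rewrite /= path_sortedE; last first.
      by move=> x y z /= yx xz; apply: leq_trans xz yx.
    move=> /andP[/allP lam_le _]; apply/allP => x /lam_le /= le_xn.
    by move/eqP: n1; rewrite -!subn1 !subn_eq0; exact: leq_trans.
  rewrite (_ : [seq _ <- _ | _] = [::]) /=; last first.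
    apply/eqP; rewrite -[_ == _]negbK -has_filter -all_predC all_map.
    by apply: sub_all lam1 => x /=; rewrite negbK.
  rewrite n1; congr (_ :: _); apply/esym; rewrite -(size_map predn lam).
  by apply/all_pred1P; rewrite all_map; exact: lam1.
rewrite -map_comp map_id_in // => x /= xlam; rewrite prednK // lt0n.
by apply: contraNneq lam0 => <-.
Qed.

Lemma sumn_strip lam :
  0%N \notin lam -> (sumn (strip lam) + size lam)%N = sumn lam.
Proof.
rewrite /strip; elim: lam => // n lam IH; rewrite inE negb_or eq_sym /=.
case: n => // n /andP[_ /IH {}IH]; rewrite -IH /=.
by case: n => [|n] /=; rewrite !addnS // addSn addnA.
Qed.

(** Linear independence of the [h_part], in a form that tolerates repetitions in the list [s].
    Induction on a bound for the degree, then on one for the number of parts: setting each variable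
    to zero turns the relation into a polynomial with all [- x_j] as roots, whose top coefficient is
    a relation between partitions without their first column. *)
Lemma h_part_free (s : seq (Zqt * seq nat)) (F : seq nat -> Zqt) :
    {in s, forall p, is_part p.2} ->
  \sum_(p <- s) p.1 *: h_part p.2 = 0 -> \sum_(p <- s) p.1 * F p.2 = 0.
Proof.
have [N] : exists N, {in s, forall p, (sumn p.2 < N)%N}.
  exists (\sum_(p <- s) sumn p.2).+1 => p ps.
  by rewrite ltnS (big_rem p) ?leq_addr.
elim: N s F => [|N IHN] s F.
  by case: s => [|p s] sN; [rewrite !big_nil | have := sN p (mem_head _ _)].
have [l] : exists l, {in s, forall p, (size p.2 <= l)%N}.
  exists (\sum_(p <- s) size p.2)%N => p ps.
  by rewrite (big_rem p) ?leq_addr.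
elim: l s F => [|l IHl] s F sl sN s_part s0.
  have s_nil p : p \in s -> p.2 = [::].
    by move=> /sl; rewrite leqn0 => /nilP.
  transitivity ((\sum_(p <- s) p.1) * F [::]).
    by rewrite big_distrl /=; apply: eq_big_seq => p /s_nil ->.
  suff -> : \sum_(p <- s) p.1 = 0 by rewrite mul0r.
  transitivity ((\sum_(p <- s) p.1 *: h_part p.2)@_[mset0]); last by rewrite s0.
  rewrite coef_fps_sum; apply: eq_big_seq => p /s_nil ->.
  by rewrite coef_fpsZ /h_part big_nil coef_fps1 eqxx mulr1.
pose Q := \sum_(p <- s) (p.1 *: (1 : xseries) : xseries) *: h_shift p.2.
have Q0 : Q = 0.
  apply: poly_fpsX_roots => j; have /esym := congr1 (kill (predC1 j)) s0.
  rewrite kill0 kill_sum => ->; rewrite /Q horner_sum; apply: eq_bigr => p _.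
  by rewrite hornerZ horner_h_shift -fps_scalerAl mul1r killZ.
(* The terms with the most parts cancel by themselves: their stripped partitions have smaller
   degree, and [unstrip] recovers the original ones. *)
have top G : \sum_(p <- s | size p.2 == l.+1) p.1 * G p.2 = 0.
  pose s' := [seq (p.1, strip p.2) | p <- s & size p.2 == l.+1].
  have : \sum_(p <- s') p.1 * (G \o unstrip l.+1) p.2 = 0.
    apply: IHN.
    - move=> _ /mapP[p + ->] /=; rewrite mem_filter => /andP[/eqP szp ps].
      rewrite -ltnS (leq_trans _ (sN p ps)) // ltnS.
      have /andP[_ p0] := s_part p ps.
      by rewrite -(sumn_strip p0) szp addnS ltnS leq_addr.
    - move=> _ /mapP[p + ->] /=; rewrite mem_filter => /andP[_ ps].
      exact/strip_part/s_part.
    rewrite big_map big_filter /=.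
    have := congr1 (fun p : {poly xseries} => p`_l.+1) Q0.
    rewrite coef0 coef_sum => Ql.
    rewrite -[RHS]Ql [RHS](bigID (fun p => size p.2 == l.+1)).
    rewrite /= [X in _ + X]big_seq_cond [X in _ + X]big1 ?addr0.
      rewrite big_seq_cond [RHS]big_seq_cond; apply: eq_bigr => p.
      move=> /andP[/s_part/andP[_ p0] /eqP szp].
      by rewrite coefZ -szp coef_h_shift // -fps_scalerAl mul1r.
    move=> p /andP[ps pl]; rewrite coefZ nth_default ?mulr0 //.
    rewrite (leq_trans (size_h_shift _)) // ltn_neqAle pl.
    exact: sl.
  rewrite big_map big_filter /= => top; rewrite -[RHS]top big_seq_cond [RHS]big_seq_cond.
  apply: eq_bigr => p /andP[/s_part p_part /eqP szp] /=.
  by rewrite -szp stripK.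
rewrite (bigID (fun p => size p.2 == l.+1)) /= top add0r -big_filter.
apply: IHl.
- move=> p; rewrite mem_filter => /andP[pl ps].
  by rewrite -ltnS ltn_neqAle pl sl.
- by move=> p; rewrite mem_filter => /andP[_ /sN].
- by move=> p; rewrite mem_filter => /andP[_ /s_part].
rewrite big_filter -[RHS]s0 [RHS](bigID (fun p => size p.2 == l.+1)) /=.
rewrite [X in _ = X + _](_ : _ = 0) ?add0r //.
apply/fpsP => m; rewrite coef_fps_sum -[RHS](top (fun lam => (h_part lam)@_[m])).
exact: eq_bigr.
Qed.

Lemma fsbig_list (V : nmodType) (T : choiceType) (A : set T) (r : seq T)
    (f : T -> V) : uniq r -> [set` r] `<=` A ->
    (forall i, A i -> i \notin r -> f i = 0) ->
  \sum_(i \in A) f i = \sum_(i <- r) f i.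
Proof.
move=> r_uniq rA f0; rewrite [RHS]fsbig_seq //.
apply: esym; apply: fsbig_widen => // i [Ai ri].
by apply: f0 => //; apply/negP.
Qed.

(** The coordinates in [hall] come from a choice of expansion; by linear independence any other
    expansion gives the same value. *)
Lemma hallE f g (s : seq (Zqt * seq nat)) :
    {in s, forall p, is_part p.2} -> g = \sum_(p <- s) p.1 *: h_part p.2 ->
  hall f g = \sum_(p <- s) p.1 * f@_[part_mon p.2].
Proof.
move=> s_part def_g.
have [c_fin def_c] : [set c | h_expansion g c] (h_coord g).
  rewrite /h_coord; apply: (xgetPex (fun=> 0)).
  (* Collecting equal partitions of [s] shows that an expansion exists, so the chosen one is not the
     default value. *)
  pose c lam := \sum_(p <- s | p.2 == lam) p.1.
  pose r := undup (map snd s).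
  have c_out lam : lam \notin r -> c lam = 0.
    rewrite mem_undup => lam_s; rewrite /c big_seq_cond big1 // => p.
    by case/andP=> ps /eqP pl; case/negP: lam_s; apply/mapP; exists p.
  exists c; split.
    apply: (@sub_finite_set _ _ [set` r]); last exact: finite_seq.
    by move=> lam /= [_]; case: (boolP (lam \in r)) => // /c_out ->.
  rewrite (@fsbig_list _ _ _ r) ?undup_uniq //; last 2 first.
  - by move=> lam; rewrite /= mem_undup => /mapP[p /s_part + ->].
  - by move=> lam _ /c_out ->; rewrite scale0r.
  transitivity (\sum_(lam <- r) \sum_(p <- s | p.2 == lam) p.1 *: h_part lam).
    rewrite (exchange_big_dep xpredT) //= def_g; apply: eq_big_seq => p ps.
    have pr : p.2 \in r by rewrite mem_undup; apply/mapP; exists p.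
    rewrite big_mkcond (bigD1_seq p.2) ?undup_uniq //= eqxx.
    rewrite big1 ?addr0 // => lam.
    by rewrite eq_sym => /negPf ->.
  by apply: eq_bigr => lam _; rewrite -scaler_suml.
set D := [set _ | _] in c_fin; pose r : seq (seq nat) := fset_set D.
have mem_r lam : lam \in r -> D lam by rewrite in_fset_set // inE.
have c_out lam : is_part lam -> lam \notin r -> h_coord g lam = 0.
  move=> lam_part; rewrite in_fset_set // => lam_r.
  by apply: contraNeq lam_r => c0; rewrite inE; split => //; apply/eqP.
have r_sub : [set` r] `<=` is_part by move=> lam /mem_r[].
rewrite /hall (@fsbig_list _ _ _ r) ?fset_uniq //; last first.
  by move=> lam lamP /(c_out _ lamP) ->; rewrite mul0r.
rewrite (@fsbig_list _ _ _ r) ?fset_uniq // in def_c; last first.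
  by move=> lam lamP /(c_out _ lamP) ->; rewrite scale0r.
pose s' := [seq (h_coord g lam, lam) | lam <- r] ++ [seq (- p.1, p.2) | p <- s].
have s'_part : {in s', forall p, is_part p.2}.
  move=> p; rewrite mem_cat => /orP[] /mapP[x xP ->] /=; last exact: s_part.
  exact: r_sub.
have s'0 : \sum_(p <- s') p.1 *: h_part p.2 = 0.
  rewrite big_cat !big_map /= -def_c.
  by under eq_bigr do rewrite scaleNr; rewrite sumrN -def_g subrr.
have := h_part_free (fun lam => f@_[part_mon lam]) s'_part s'0.
rewrite big_cat !big_map /=.
under [X in _ + X = _ -> _]eq_bigr do rewrite mulNr.
by rewrite sumrN => /eqP; rewrite subr_eq0 => /eqP.
Qed.

Lemma part_sort beta : is_part (sort geq [seq n <- beta | n != 0%N]).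
Proof.
apply/andP; split; last by rewrite mem_sort mem_filter eqxx.
by apply: sort_sorted => x y /=; exact: leq_total.
Qed.

(* [N k beta] computes the pairing with [e_ k * h_part beta]; the recurrence is
   that of [e_ k] in terms of the [h_ i] and of smaller [e_ j]. *)
Lemma e_h_expansion k beta : exists2 s : seq (Zqt * seq nat),
    {in s, forall p, is_part p.2} /\
    e_ k * h_part beta = \sum_(p <- s) p.1 *: h_part p.2 &
  forall (F : seq nat -> Zqt) (N : nat -> seq nat -> Zqt),
    (forall b, N 0%N b = F (sort geq [seq n <- b | n != 0%N])) ->
    (forall j b, \sum_(i < j.+2) (-1) ^+ i * N (j.+1 - i)%N
                    (if val i is 0 then b else val i :: b) = 0) ->
  N k beta = \sum_(p <- s) p.1 * F p.2.
Proof.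
have [n] := ubnP k; elim: n => // n IHn in k beta *.
case: k => [_|k]; last first.
  rewrite ltnS => le_kn.
  have {}IHn (i : nat) :=
    IHn (k - i)%N (i.+1 :: beta) (leq_ltn_trans (leq_subr i k) le_kn).
  (* Concatenates the lists that the induction hypothesis yields for the separate terms. *)
  have expand l : exists2 s : seq (Zqt * seq nat),
      {in s, forall p, is_part p.2} /\
      \sum_(i < l) (-1) ^+ i * (e_ (k - i) * h_part (i.+1 :: beta)) =
        \sum_(p <- s) p.1 *: h_part p.2 &
    forall (F : seq nat -> Zqt) (N : nat -> seq nat -> Zqt),
      (forall b, N 0%N b = F (sort geq [seq n <- b | n != 0%N])) ->
      (forall j b, \sum_(i < j.+2) (-1) ^+ i * N (j.+1 - i)%N
                      (if val i is 0 then b else val i :: b) = 0) ->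
      \sum_(i < l) (-1) ^+ i * N (k - i)%N ((val i).+1 :: beta) =
        \sum_(p <- s) p.1 * F p.2.
    elim: l => [|j [s [s_part def_s] sN]].
      exists [::]; first by rewrite big_ord0 big_nil.
      by move=> F N _ _; rewrite big_ord0 big_nil.
    have [s1 [s1_part def_s1] s1N] := IHn j.
    exists (s ++ [seq ((-1) ^+ j * p.1, p.2) | p <- s1]).
      split=> [p|].
        rewrite mem_cat => /orP[/s_part //|/mapP[p1 /s1_part ? ->] //].
      rewrite big_ord_recr big_cat big_map /= def_s; congr (_ + _).
      rewrite def_s1 big_distrr; apply: eq_bigr => p _ /=.
      rewrite -(signr_odd xseries) -(signr_odd Zqt) !mulr_sign.
      by case: odd; rewrite ?scaleNr.
    move=> F N N0 NS; rewrite big_ord_recr big_cat big_map /= (sN F) //.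
    rewrite (s1N F) //; congr (_ + _); rewrite big_distrr.
    by apply: eq_bigr => p _; rewrite /= mulrA.
  have [s [s_part def_s] sN] := expand k.+1; exists s; first split=> //.
    (* The alternating relation is solved for its term [i = 0], which is [e_ k.+1] because
       [h_ 0 = 1]. *)
    rewrite -def_s; apply/eqP; rewrite -subr_eq0; apply/eqP.
    transitivity ((\sum_(i < k.+2) (-1) ^+ i * (e_ (k.+1 - i) * h_ i)) * h_part beta).
      rewrite [in RHS]big_ord_recl /= expr0 mul1r h_0 mulr1 mulrDl; congr (_ + _).
      rewrite big_distrl -sumrN; apply: eq_bigr => i _ /=.
      by rewrite exprS mulN1r !mulNr /h_part big_cons !mulrA.
    by rewrite sum_he ?mul0r.
  move=> F N N0 NS; have := NS k beta; rewrite -(sN F N N0 NS) big_ord_recl /=.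
  rewrite expr0 mul1r subn0 => /eqP; rewrite addr_eq0 => /eqP ->.
  rewrite -sumrN; apply: eq_bigr => i _ /=.
  by rewrite exprS mulN1r mulNr opprK.
exists [:: (1, sort geq [seq n <- beta | n != 0%N])].
  split=> [p|]; first by rewrite inE => /eqP ->; exact: part_sort.
  rewrite big_seq1 scale1r e_0 mul1r -(h_part_filter beta).
  by apply: h_part_perm; rewrite perm_sym perm_sort.
by move=> F N N0 _; rewrite N0 big_seq1 mul1r.
Qed.
End HallExpansions.

(** * The recurrence modulo powers of q *)

Lemma big_tuple_cons (V : nmodType) (T : finType) n (F : seq T -> V) :
  \sum_(s : n.+1.-tuple T) F s = \sum_(x : T) \sum_(s : n.-tuple T) F (x :: s).
Proof.
rewrite pair_big /= (reindex (fun p : T * n.-tuple T => cons_tuple p.1 p.2)) //=.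
exists (fun s : n.+1.-tuple T => (thead s, behead_tuple s)) => [[x s] _|s _] /=.
  by congr (_, _); apply: val_inj.
by rewrite [RHS]tuple_eta; apply: val_inj.
Qed.

(** * Sums over words with bounded letters *)

Section BoundedSums.
Variable V : nmodType.
Implicit Types (F : seq nat -> V).

Definition bsum n D F : V := \sum_(s : n.-tuple 'I_D) F (map val s).

Lemma eq_bsum n D F F' :
  (forall s, size s = n -> F s = F' s) -> bsum n D F = bsum n D F'.
Proof. by move=> FF'; apply: eq_bigr => s _; rewrite FF' // size_map size_tuple. Qed.

Lemma bsum0 D F : bsum 0 D F = F [::].
Proof. by rewrite /bsum (big_pred1 [tuple]) // => s; apply/esym/eqP/tuple0. Qed.

Lemma bsum_cons n D F :
  bsum n.+1 D F = \sum_(x < D) bsum n D (fun s => F (val x :: s)).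
Proof. exact: (big_tuple_cons _ (fun s => F (map val s))). Qed.

Lemma bsum_rcons n D F :
  bsum n.+1 D F = \sum_(x < D) bsum n D (fun s => F (rcons s (val x))).
Proof.
elim: n F => [|n IHn] F; rewrite bsum_cons.
  by apply: eq_bigr => x _; rewrite !bsum0.
under eq_bigr do rewrite IHn.
by rewrite exchange_big; apply: eq_bigr => x _; rewrite bsum_cons.
Qed.

(** The heights of the cells, those of height 0 being marked by [v]. The other heights are stored in
    [g] lowered by one, so that the area is the sum of [g]. *)
Fixpoint insert_zeros (v : seq bool) (g : seq nat) : seq nat :=
  match v with
  | [::] => [::]
  | true :: v' => 0%N :: insert_zeros v' g
  | false :: v' => (head 0%N g).+1 :: insert_zeros v' (behead g)
  end.

Lemma bsum_insert_zeros n D F :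
  bsum n D.+1 F = \sum_(w : n.-tuple bool)
    bsum (count negb w) D (fun g => F (insert_zeros w g)).
Proof.
elim: n F => [|n IHn] F.
  by rewrite bsum0 (big_pred1 [tuple]) ?bsum0 // => s; apply/esym/eqP/tuple0.
rewrite bsum_cons big_ord_recl /= IHn.
rewrite (big_tuple_cons _
  (fun w => bsum (count negb w) D (fun g => F (insert_zeros w g)))) big_bool /=.
congr (_ + _); under eq_bigr do rewrite IHn.
by rewrite exchange_big; apply: eq_bigr => w _; rewrite bsum_cons.
Qed.

End BoundedSums.

Lemma size_insert_zeros v g : size (insert_zeros v g) = size v.
Proof. by elim: v g => //= -[] v IH g /=; rewrite IH. Qed.

Lemma sumn_insert_zeros v g : size g = count negb v ->
  sumn (insert_zeros v g) = (sumn g + count negb v)%N.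
Proof.
elim: v g => [|[] v IH] g /=; first by case: g.
  by move=> /IH ->.
by case: g => // x g [/IH] /= ->; rewrite addSn addnS addnA.
Qed.

Lemma insert_zerosK v g : map (fun x => x == 0%N) (insert_zeros v g) = v.
Proof. by elim: v g => //= -[] v IH g /=; rewrite IH. Qed.

Lemma count_insert_zeros v g x : size g = count negb v ->
  count_mem x (insert_zeros v g) =
    if x is y.+1 then count_mem y g else ones v.
Proof.
elim: v g => [|[] v IH] g /=; first by case: g x => // -[].
  by case: x IH => [|x] IH /IH ->.
by case: g => // z g [/IH] /= ->; case: x {IH}.
Qed.

Lemma rcons_insert_zeros0 v g : size g = count negb v ->
  rcons (insert_zeros v g) 0%N = insert_zeros (rcons v true) g.
Proof.
elim: v g => [|[] v IH] g /=; first by case: g.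
  by move=> /IH ->.
by case: g => // z g [/IH] /= ->.
Qed.

Lemma rcons_insert_zerosS v g x : size g = count negb v ->
  rcons (insert_zeros v g) x.+1 = insert_zeros (rcons v false) (rcons g x).
Proof.
elim: v g => [|[] v IH] g /=; first by case: g.
  by move=> /IH ->.
by case: g => // z g [/IH] /= ->.
Qed.

(* [weight [::] s] is the product over [i] of
   [a + t ^ (#{j < i : s_j = s_i} + #{j > i : s_j = s_i + 1})]. *)
Fixpoint weight (pre s : seq nat) : {poly Zqt} :=
  if s is x :: s' then
    ((t ^+ (count_mem x pre + count_mem x.+1 s'))%:P + 'X) * weight (rcons pre x) s'
  else 1.

(** [P_] computed from left to right: [k] counts the ones already read, and [w] keeps the letters of
    the zeros still to come. *)
Fixpoint P_seq (k : nat) (v w : seq bool) : {poly Zqt} :=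
  match v with
  | [::] => 1
  | true :: v' => ((t ^+ (k + ones w))%:P + 'X) * P_seq k.+1 v' w
  | false :: v' => P_seq k v' (behead w)
  end.

Lemma ones_rcons v b : ones (rcons v b) = (ones v + b)%N.
Proof. by rewrite /ones -cats1 count_cat /= addn0. Qed.

(** A cell of height 0 sees the earlier cells of height 0 and the later ones of height 1, which
    gives the factors of [P_seq]. The other cells see only positive heights, and these may all be
    lowered by one. *)
Lemma weight_insert_zeros v0 g0 v g :
    size g0 = count negb v0 -> size g = count negb v ->
  weight (insert_zeros v0 g0) (insert_zeros v g) =
    P_seq (ones v0) v (map (fun x => x == 0%N) g) * weight g0 g.
Proof.
elim: v v0 g0 g => [|[] v IH] v0 g0 g sz0 /=.
- by case: g => // _; rewrite mulr1.
- rewrite add0n => sz; rewrite !count_insert_zeros // rcons_insert_zeros0 //.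
  have sz1 : size g0 = count negb (rcons v0 true) by rewrite -cats1 count_cat addn0.
  rewrite (IH _ _ _ sz1 sz) mulrA; congr (_ * _ * _).
    by rewrite /ones count_map.
  by rewrite ones_rcons addn1.
case: g => // x g [sz] /=; rewrite !count_insert_zeros // rcons_insert_zerosS //.
have sz1 : size (rcons g0 x) = count negb (rcons v0 false).
  by rewrite size_rcons -cats1 count_cat /= addn1 sz0.
rewrite (IH _ _ _ sz1 sz) mulrCA; congr (_ * _).
by rewrite ones_rcons addn0.
Qed.

(** Rotation of the last cell to the front, one level lower: a cell of height [x] sees it first as a
    later cell of height [x.+1], then as an earlier one of height [x]. *)
Lemma weight_rcons pre s x : weight pre (rcons s x.+1) =
  ((t ^+ count_mem x.+1 (pre ++ s))%:P + 'X) * weight (x :: pre) s.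
Proof.
elim: s pre => [|y s IH] pre /=; first by rewrite cats0 addn0.
rewrite IH cat_rcons mulrCA -[rcons s _]cats1 count_cat /= addn0.
by rewrite eqSS addnA addnC addnA.
Qed.

(** The same rotation for a last cell of height 0; instead of lowering it, the other cells are
    raised. *)
Lemma weight_rcons0 pre s : weight pre (rcons s 0%N) =
  ((t ^+ count_mem 0%N (pre ++ s))%:P + 'X) * weight (0%N :: map S pre) (map S s).
Proof.
elim: s pre => [|y s IH] pre /=; first by rewrite cats0 addn0.
rewrite IH cat_rcons mulrCA -[rcons s _]cats1 count_cat /= !addn0 add0n map_rcons.
by rewrite !count_map.
Qed.

Lemma card_ord_lt n i (p : pred nat) : (i <= n)%N ->
  #|[pred j : 'I_n | (j < i)%N && p j]| = count p (iota 0 i).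
Proof.
move=> le_in; rewrite -sum1_card -[RHS]sum1_count -[X in iota 0 X]subn0.
rewrite -[iota 0 _]/(index_iota 0 i) big_mkord.
rewrite (big_ord_widen_cond n p (fun=> 1%N)) //.
by apply: eq_bigl => j; rewrite inE andbC.
Qed.

Lemma card_ord_gt n i (p : pred nat) :
  #|[pred j : 'I_n | (i < j)%N && p j]| = count p (iota i.+1 (n - i.+1)).
Proof.
rewrite -sum1_card -[RHS]sum1_count -[iota _ _]/(index_iota i.+1 n).
rewrite big_geq_mkord; apply: eq_bigl => j.
by rewrite inE andbC.
Qed.

Lemma count_iota_take (T : Type) (x0 : T) (p : pred T) s i : (i <= size s)%N ->
  count (fun j => p (nth x0 s j)) (iota 0 i) = count p (take i s).
Proof.
move=> le_i; rewrite -[s in RHS]drop0 -(map_nth_iota x0) ?subn0 //.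
by rewrite count_map.
Qed.

Lemma count_iota_drop (T : Type) (x0 : T) (p : pred T) s i :
  count (fun j => p (nth x0 s j)) (iota i (size s - i)) = count p (drop i s).
Proof.
have [le_i|lt_i] := leqP i (size s).
  rewrite -[drop i s](@take_size _ (drop i s)) size_drop -(map_nth_iota x0) //.
  by rewrite count_map.
by rewrite drop_oversize 1?ltnW // (eqP (ltnW lt_i)).
Qed.

Lemma count_u_2 v w i : (i <= size v)%N -> size w = count negb v ->
  count (fun j => u_ v w j == 2%N) (iota i (size v - i)) =
  ones (drop (count negb (take i v)) w).
Proof.
have [k] : exists k, (size v - i = k)%N by eexists.
elim: k i => [|k IHk] i.
  move=> vi le_iv szw.
  have -> : i = size v by lia.
  by rewrite subnn take_size -szw drop_size.
move=> def_k le_iv szw; have lt_iv : (i < size v)%N by lia.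
rewrite (_ : size v - i = (size v - i.+1).+1)%N /=; last by lia.
rewrite IHk //; last by lia.
rewrite (take_nth false lt_iv) -cats1 count_cat /= addn0 /u_.
have [vi|vi] := boolP (nth false v i); first by rewrite addn0.
rewrite /= addn1.
have lt_w : (count negb (take i v) < size w)%N.
  rewrite szw -{2}(cat_take_drop i.+1 v) count_cat (take_nth false lt_iv).
  by rewrite -cats1 count_cat /= vi; lia.
rewrite (drop_nth false lt_w) /=.
by case: (nth false w _).
Qed.

Lemma P_seqE k v w : size w = count negb v ->
  P_seq k v w = \prod_(i < size v | nth false v i)
   ((t ^+ (k + ones (take i v) + ones (drop (count negb (take i v)) w)))%:P + 'X).
Proof.
elim: v k w => [|b v IH] k w /=; first by rewrite big_ord0.
rewrite big_mkcond big_ord_recl /= -big_mkcond /=.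
case: b => /= => [|szw].
  rewrite add0n => szw; rewrite IH // drop0 addn0; congr (_ * _).
  by apply: eq_bigr => i _; rewrite add0n add1n addnS addSn.
rewrite mul1r IH ?size_behead ?szw //; apply: eq_bigr => i _.
by rewrite !add0n add1n -drop1 drop_drop addn1.
Qed.

Lemma P_E v w : size w = count negb v -> P_ v w = P_seq 0 v w.
Proof.
move=> szw; rewrite P_seqE // /P_; apply: eq_bigr => i vi.
congr ((t ^+ (_ + _))%:P + _).
  rewrite (@card_ord_lt _ _ (fun j => u_ v w j == 1%N)); last exact: ltnW.
  rewrite add0n /ones -(count_iota_take false) 1?ltnW //; apply: eq_count => j /=.
  by rewrite /u_; case: (nth _ v j) => //; case: (nth _ w _).
rewrite (@card_ord_gt _ _ (fun j => u_ v w j == 2%N)) count_u_2 //.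
rewrite (take_nth false (ltn_ord i)) -cats1 count_cat.
by rewrite vi /= !addn0.
Qed.

(** The sum over [gamma] of the weighted powers of [q], restricted to heights at most [D]. *)
Definition partial_f D v : {poly Zqt} := bsum (count negb v) D
  (fun g => (q ^+ sumn g)%:P * weight [::] (insert_zeros v g)).

(** The word [w] records which of the remaining cells have height 1; after the cells of height 0 are
    split off, these become the lowest ones. *)
Lemma partial_f_rec D v : partial_f D.+1 v =
  \sum_(w : (size v - ones v).-tuple bool)
    (q ^+ (size v - ones v - ones w))%:P * P_ v w * partial_f D w.
Proof.
have -> : (size v - ones v)%N = count negb v.
  by rewrite -(count_predC id v) addKn.
rewrite /partial_f bsum_insert_zeros; apply: eq_bigr => w _.
have szw : size w = count negb v by rewrite size_tuple.
rewrite [in RHS]/bsum big_distrr /=; apply: eq_bigr => g _.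
set s := map val g; have szs : size s = count negb w by rewrite size_map size_tuple.
rewrite (@weight_insert_zeros [::] [::]) ?size_insert_zeros // insert_zerosK.
have -> : (count negb v - ones w = count negb w)%N.
  rewrite -[LHS]addn0 addnC; have := count_predC id w.
  by rewrite szw => /(canRL (addKn _)).
rewrite sumn_insert_zeros // exprD rmorphM P_E //.
by rewrite -!mulrA mulrCA; congr (_ * _); rewrite mulrCA.
Qed.

(* Divisibility by [q ^ k]. *)
Definition small k (x : Zqt) : Prop :=
  forall m : {mset 'I_2}, (m ord0 < k)%N -> x@_[m] = 0.

Lemma smallD k x y : small k x -> small k y -> small k (x + y).
Proof. by move=> sx sy m mk; rewrite coef_fpsD sx ?sy ?addr0. Qed.

Lemma smallMl k x y : small k y -> small k (x * y).
Proof.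
move=> sy m mk; rewrite coef_fpsM big_seq big1 // => p.
rewrite mem_factor_seq => /eqP def_m; rewrite sy ?mulr0 //.
by apply: leq_ltn_trans mk; rewrite -def_m msetE2 leq_addl.
Qed.

Lemma small_qX k : small k (q ^+ k).
Proof.
move=> m mk; apply/eqP; apply: contraTT mk => /eqP/coef_qX_neq0 <-.
by rewrite ltnn.
Qed.

Lemma small_eq0 x : (forall k, small k x) -> x = 0.
Proof. by move=> x0; apply/fpsP => m; exact: (x0 (m ord0).+1). Qed.

Lemma small0 k : small k 0.
Proof. by []. Qed.

Lemma small_sum k (J : Type) (s : seq J) (P : pred J) (F : J -> Zqt) :
  (forall j, P j -> small k (F j)) -> small k (\sum_(j <- s | P j) F j).
Proof. by move=> sF; apply: big_ind => //; exact: smallD. Qed.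

Definition smallp k (p : {poly Zqt}) : Prop := forall d, small k p`_d.

Lemma smallpD k p r : smallp k p -> smallp k r -> smallp k (p + r).
Proof. by move=> sp sr d; rewrite coefD; apply: smallD. Qed.

Lemma smallpMl k p r : smallp k r -> smallp k (p * r).
Proof. by move=> sr d; rewrite coefM; apply: small_sum => i _; apply: smallMl. Qed.

Lemma smallp_sum k (J : Type) (s : seq J) (P : pred J) (F : J -> {poly Zqt}) :
  (forall j, P j -> smallp k (F j)) -> smallp k (\sum_(j <- s | P j) F j).
Proof.
move=> sF; apply: big_ind => //; last exact: smallpD.
by move=> d; rewrite coef0.
Qed.

Lemma smallp_qX k : smallp k (q ^+ k)%:P.
Proof.
by move=> d; rewrite coefC; case: ifP => _; [exact: small_qX | exact: small0].
Qed.

(** A last letter 0 yields the word [10^n], and rotation turns a last letter [x.+1] into a first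
    letter [x] at the cost of a factor [q]. Only the first letter [D] is not reached, which leaves
    the error term. *)
Lemma partial_f_zeros n D : exists r,
  (1 - q%:P) * partial_f D.+1 (nseq n.+1 false) =
  partial_f D.+1 (true :: nseq n false) - (q ^+ D.+1)%:P * r.
Proof.
have cnt k : count negb (nseq k false) = k by rewrite count_nseq mul1n.
have ins k s : size s = k -> insert_zeros (nseq k false) s = map S s.
  by elim: k s => [|k IH] [|x s] //= [/IH ->].
have weightS s : weight [::] (map S s) = weight [::] s.
  rewrite -(ins (size s)) // (@weight_insert_zeros [::] [::]) ?cnt //.
  suff -> k w : P_seq 0 (nseq k false) w = 1 by rewrite mul1r.
  by elim: k w => //= k IH w.
pose F s := (q ^+ sumn s)%:P * weight [::] s.
have f0 : partial_f D.+1 (nseq n.+1 false) = bsum n.+1 D.+1 F.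
  by rewrite /partial_f cnt; apply: eq_bsum => s szs; rewrite ins // weightS.
exists (bsum n D.+1 (fun s => (q ^+ sumn s)%:P * weight [::] (D :: s))).
have F_cons (x : nat) : bsum n D.+1 (fun s => F (x :: s)) =
    (q ^+ x)%:P * bsum n D.+1 (fun s => (q ^+ sumn s)%:P * weight [::] (x :: s)).
  rewrite /bsum big_distrr; apply: eq_bigr => s _.
  by rewrite /F /= exprD rmorphM mulrA.
have F_rconsS (x : nat) : bsum n D.+1 (fun s => F (rcons s x.+1)) =
    q%:P * bsum n D.+1 (fun s => F (x :: s)).
  rewrite /bsum big_distrr; apply: eq_bigr => s _.
  rewrite /F sumn_rcons weight_rcons /= addnS exprS rmorphM -!mulrA addnC.
  by congr (_ * (_ * (_ * _))).
have F_rcons0 : bsum n D.+1 (fun s => F (rcons s 0%N)) =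
    partial_f D.+1 (true :: nseq n false).
  rewrite /partial_f /= add0n cnt; apply: eq_bsum => s szs.
  rewrite /F sumn_rcons addn0 ins // weight_rcons0 /= add0n; congr (_ * (_ * _)).
  by rewrite count_map.
rewrite f0 mulrBl mul1r {1}bsum_rcons big_ord_recl /= F_rcons0.
under eq_bigr do rewrite F_rconsS.
rewrite -big_distrr bsum_cons big_ord_recr /= F_cons.
rewrite mulrDr opprD addrA addrK exprS rmorphM mulrA.
by [].
Qed.

(** Each use of the recurrence lowers [D] by one and the length by at least one, so the precision
    [k] is kept. It stops at the empty word, where both sides are 1. *)
Lemma partial_f_limit k v D : (k + size v <= D)%N -> smallp k (f_ v - partial_f D v).
Proof.
have [n] := ubnP (size v); elim: n => // n IHn in k v D *.
rewrite ltnS => le_vn le_D.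
(* Stated for all words [u] of the length of [v], since a word of zeros is reduced to one of the
   same length with a leading 1. *)
have step u E : size u = size v -> true \in u -> (k + size v <= E)%N ->
    smallp k (f_ u - partial_f E u).
  move=> szu u1; case: E => [|E] le_E.
    by case: u u1 szu => // b u _ szu; move: le_E; rewrite -szu addnS.
  rewrite f_rec // partial_f_rec -sumrB; apply: smallp_sum => w _.
  rewrite -mulrBr; apply: smallpMl.
  have lt_w : (size w < size v)%N by rewrite size_tuple -szu zeros_lt.
  apply: IHn; first exact: leq_trans le_vn.
  by rewrite -ltnS (leq_trans _ le_E) // -addnS leq_add2l.
case: (boolP (true \in v)) => [v1|v0]; first exact: step.
have def_v : v = nseq (size v) false.
  by apply/all_pred1P/allP => -[] // v1; rewrite v1 in v0.
move: def_v le_D step; case: (size v) => [|m] def_v le_D step.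
  move=> d; rewrite def_v /partial_f /= bsum0 /= mulr1 subrr coef0; exact: small0.
case: D le_D => [|D] le_D; first by rewrite addnS in le_D.
have [r def_r] := partial_f_zeros m D.
rewrite def_v f_zeros.
have geomE : geom_q%:P * (1 - q%:P) = 1 :> {poly Zqt}.
  by rewrite -[1 - _](rmorphB polyC 1) mulrC -rmorphM geom_qE.
rewrite -[partial_f _ _]mul1r -geomE -mulrA def_r -mulrBr; apply: smallpMl.
rewrite opprB addrCA addrC; apply: smallpD.
  by apply: step; rewrite //= size_nseq.
rewrite mulrC; apply: smallpMl => d j jk.
by apply: (@smallp_qX D.+1); lia.
Qed.

(** * Labelled cells *)

Section Cells.
Variables (n : nat) (s : seq nat).
Implicit Types i j : 'I_n.

(* [dinv] counts the edges of this graph along which the label increases. *)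
Definition attack i j : bool :=
  ((nth 0%N s i == nth 0%N s j) && (j < i)%N) ||
  (((nth 0%N s i).+1 == nth 0%N s j) && (i < j)%N).

(** The order by height and then from right to left. Levels are spaced by [n], so that the edges
    join exactly the cells at positive distance less than [n]. *)
Definition reading i : nat := (nth 0%N s i * n + (n - i.+1))%N.

Lemma reading_inj : injective reading.
Proof.
move=> i j; rewrite /reading => ij; apply: val_inj => /=.
have := ltn_ord i; have := ltn_ord j => lt_j lt_i.
have := congr1 (modn^~ n) ij; rewrite /= !modnMDl !modn_small; lia.
Qed.

Lemma attackE i j : attack i j = (reading i < reading j < reading i + n)%N.
Proof.
rewrite /attack /reading; have := ltn_ord i; have := ltn_ord j => lt_j lt_i.
move: (nth _ s i) (nth _ s j) => a b.
have [lt_ab|lt_ba|->] := ltngtP a b; last by rewrite ?eqxx; lia.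
  have [<-|ne] := eqVneq a.+1 b; first by rewrite mulSn; lia.
  have : (a.+2 * n <= b * n)%N by rewrite leq_mul2r; lia.
  by rewrite !mulSn; lia.
have : (b.+1 * n <= a * n)%N by rewrite leq_mul2r; lia.
by rewrite mulSn; lia.
Qed.

Lemma attack_unit_interval : unit_interval reading attack [set: 'I_n]%SET.
Proof.
split=> [i j _ _|i j _ _ i' j' _ _]; first by rewrite attackE => /andP[].
by rewrite !attackE; lia.
Qed.

Lemma out_deg_attack i : size s = n ->
  out_deg attack [set: 'I_n]%SET i =
  (count_mem (nth 0%N s i) (take i s) + count_mem (nth 0%N s i).+1 (drop i.+1 s))%N.
Proof.
move=> szs; rewrite -(count_iota_take 0%N); last by rewrite szs ltnW.
rewrite -(count_iota_drop 0%N) szs.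
rewrite -(@card_ord_lt n _ (fun k => nth 0%N s k == nth 0%N s i)) 1?ltnW //.
rewrite -(@card_ord_gt n _ (fun k => nth 0%N s k == (nth 0%N s i).+1)).
rewrite -!sum1_card [X in (X + _)%N]big_mkcond [X in (_ + X)%N]big_mkcond /=.
rewrite -big_split /out_deg [LHS]big_mkcond.
apply: eq_bigr => j _; rewrite !inE /attack /=.
rewrite [nth 0%N s j == _]eq_sym [nth 0%N s j == _.+1]eq_sym.
case: ltngtP => ij; rewrite ?andbF ?andbT ?orbF /=; by do ?case: (_ == _).
Qed.

End Cells.

Lemma weight_prod pre s : weight pre s =
  \prod_(i < size s) ((t ^+ (count_mem (nth 0%N s i) (pre ++ take i s) +
     count_mem (nth 0%N s i).+1 (drop i.+1 s)))%:P + 'X).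
Proof.
elim: s pre => [|x s IH] pre; first by rewrite big_ord0.
rewrite big_ord_recl /= cats0 drop0 IH; congr (_ * _).
by apply: eq_bigr => i _; rewrite cat_rcons.
Qed.

Lemma weight_attack n s : size s = n ->
  weight [::] s =
  \prod_(i < n) ((t ^+ out_deg (@attack n s) [set: 'I_n]%SET i)%:P + 'X).
Proof.
move=> szs; rewrite weight_prod szs; apply: eq_bigr => i _.
by rewrite out_deg_attack.
Qed.

Lemma dinv_ascents n N (gamma pi : {ffun 'I_n -> nat}) s (f : {ffun 'I_n -> 'I_N}) :
  (forall i, gamma i = nth 0%N s i) -> (forall i, pi i = f i) ->
  dinv gamma pi = ascents (@attack n s) ltn f.
Proof.
move=> def_gamma def_pi; rewrite /dinv -!sum1_card.
rewrite [X in (X + _)%N]big_mkcond [X in (_ + X)%N]big_mkcond /=.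
set P1 := [pred p | _ & _]; set P2 := [pred p | [&& _, _.+1 == _ & _]].
rewrite -(pair_bigA _ (fun i j => if (i, j) \in P1 then 1 else 0)%N) /=.
rewrite -(pair_bigA _ (fun i j => if (i, j) \in P2 then 1 else 0)%N) /=.
(* A pair of equal heights is an edge from its later to its earlier cell, hence the exchange. *)
rewrite exchange_big -big_split; apply: eq_bigr => i _ /=.
rewrite -big_split; apply: eq_bigr => j _ /=.
rewrite !inE /= !def_gamma !def_pi /attack [nth _ s j == _]eq_sym.
case: ltngtP => ij; rewrite ?andbF ?andbT ?orbF /= ?addn0 ?add0n //; by case: (_ && _).
Qed.

Lemma coef_prod_fpsX (R : comNzRingType) (J : Type) (r : seq J) (F : J -> nat)
    (m : {mset nat}) :
  (\prod_(j <- r) (fpsX (F j) : fps nat R))@_[m] =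
  (`[< forall k, m k = count (fun j => F j == k) r >])%:R.
Proof.
elim: r m => [|j r IH] m.
  rewrite big_nil coef_fps1; congr (nat_of_bool _)%:R.
  apply/eqP/asboolP => [-> k|m0]; first by rewrite mset0E.
  by apply/msetP => k; rewrite mset0E m0.
rewrite big_cons coef_fpsXM; case: ifPn => [jm|jm]; last first.
  rewrite asboolF // => /(_ (F j)) /eqP; rewrite /= eqxx.
  by move: jm; rewrite -mset_eq0 => /eqP ->.
rewrite IH; congr (nat_of_bool _)%:R; apply: asbool_equiv_eq.
have m0 : (0 < m (F j))%N by rewrite mset_gt0.
split=> mE k; have := mE k; rewrite msetB1E /= [F j == k]eq_sym.
  have [->|_] := eqVneq k (F j) => /= mk; last by rewrite -mk subn0.
  by rewrite -mk subnKC.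
have [->|_] := eqVneq k (F j) => /= ->; last by rewrite subn0.
by rewrite addKn.
Qed.

Lemma part_monE lam k : part_mon lam k = nth 0%N lam k.
Proof.
rewrite /part_mon (big_morph (fun m : {mset nat} => m k) (id1 := 0%N) (op1 := addn)).
- have [lt_k|le_k] := ltnP k (size lam).
    rewrite (bigD1 (Ordinal lt_k)) //= msetnE eqxx big1 ?addn0 // => i ne.
    rewrite msetnE; case: eqP => // ki; case/eqP: ne; exact: val_inj.
  rewrite nth_default // big1 // => i _; rewrite msetnE.
  by case: eqP => // ki; move: le_k; rewrite ki leqNgt ltn_ord.
- by move=> m1 m2; rewrite msetE2.
- by rewrite mset0E.
Qed.

Lemma coef_xmon n (pi : {ffun 'I_n -> nat}) lam :
  (xmon pi)@_[part_mon lam] =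
  (`[< forall k, #|[pred i | pi i == k]| = nth 0%N lam k >])%:R.
Proof.
rewrite /xmon coef_prod_fpsX; congr (nat_of_bool _)%:R; apply: asbool_equiv_eq.
have cnt k : #|[pred i | pi i == k]| = count (fun j => pi j == k) (index_enum 'I_n).
  by rewrite -sum1_card -sum1_count; apply: eq_bigl => i; rewrite inE.
by split=> lamE k; have := lamE k; rewrite part_monE cnt.
Qed.

(** The coefficient in [L v] of the monomial of [lam], restricted to heights at most [D]. *)
Definition llt_sum n (v : n.-tuple bool) D lam : Zqt := bsum (count negb v) D (fun g =>
  q ^+ sumn g * llt (@attack n (insert_zeros v g)) t ltn (size lam).+1 lam).

Lemma map_tuple_ord n D s : size s = n -> all (fun x => x < D)%N s ->
  exists g : n.-tuple 'I_D, map val g = s.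
Proof.
move=> szs /allP sD; case: D sD => [|D] sD.
  case: s szs sD => [<- _|x s _ sD]; first by exists [tuple].
  by have := sD x (mem_head _ _).
have sz : size (map (@inord D) s) == n by rewrite size_map szs.
exists (Tuple sz); rewrite /= -map_comp map_id_in // => x /sD xD /=.
by rewrite inordK.
Qed.

Definition drop_zeros (s : seq nat) : seq nat := [seq x.-1 | x <- s & x != 0%N].

Lemma drop_zerosK s : insert_zeros (map (fun x => x == 0%N) s) (drop_zeros s) = s.
Proof. by rewrite /drop_zeros; elim: s => //= -[|x] s IH /=; rewrite IH. Qed.

Lemma insert_zeros_dropK v g : size g = count negb v ->
  drop_zeros (insert_zeros v g) = g.
Proof.
rewrite /drop_zeros; elim: v g => [|[] v IH] g /=; first by case: g.
  by move=> /IH ->.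
by case: g => // x g [/IH] /= ->.
Qed.

Lemma sum_nth_ord n (s : seq nat) : size s = n -> (\sum_(i < n) nth 0 s i)%N = sumn s.
Proof. by move=> <-; rewrite sumnE (big_nth 0%N) big_mkord. Qed.

Lemma area_insert_zeros n (v : n.-tuple bool) (gamma : {ffun 'I_n -> nat}) g :
    size g = count negb v -> (forall i, gamma i = nth 0%N (insert_zeros v g) i) ->
  area gamma = sumn g.
Proof.
move=> szg def_gamma; rewrite /area.
have sz : size (insert_zeros v g) = n by rewrite size_insert_zeros size_tuple.
under eq_bigr do rewrite def_gamma.
rewrite sum_nth_ord // sumn_insert_zeros //.
suff -> : #|[pred i | (0 < gamma i)%N]| = count negb v by rewrite addnK.
transitivity (count (fun x => 0 < x)%N (insert_zeros v g)).
  rewrite -[X in count _ X]take_size sz -(count_iota_take 0%N) ?sz //.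
  rewrite -(@card_ord_lt n n (fun k => 0 < nth 0 (insert_zeros v g) k)%N) //.
  apply: eq_card => i.
  by rewrite !inE def_gamma ltn_ord.
by elim: (tval v) g {szg def_gamma sz} => // -[] w IH g /=; rewrite IH.
Qed.

(** In [q]-degree below [D] only heights at most [D] matter, and the monomial bounds the letters; so
    the infinite sum reduces to the image of a finite type. *)
Lemma L_llt_sum n (v : n.-tuple bool) D lam :
  small D ((L v)@_[part_mon lam] - llt_sum v D lam).
Proof.
move=> m lt_mD; rewrite coef_fpsD coef_fpsN; apply/eqP; rewrite subr_eq0; apply/eqP.
have szv : size v = n := size_tuple v.
pose word g := insert_zeros v g.
have sz_word g : size (word g) = n by rewrite size_insert_zeros.
pose N := (size lam).+1.
pose X := ((count negb v).-tuple 'I_D * {ffun 'I_n -> 'I_N})%type.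
pose h (x : X) : {ffun 'I_n -> nat} * {ffun 'I_n -> nat} :=
  ([ffun i : 'I_n => nth 0%N (word (map val x.1)) i], [ffun i => val (x.2 i)]).
pose T (gamma pi : {ffun 'I_n -> nat}) : int :=
  (q ^+ area gamma * t ^+ dinv gamma pi * (xmon pi)@_[part_mon lam])@_[m].
have sz_map (g : (count negb v).-tuple 'I_D) : size (map val g) = count negb v.
  by rewrite size_map size_tuple.
have h_inj : injective h.
  move=> [g f] [g' f'] [/ffunP eg /ffunP ef]; congr (_, _); last first.
    by apply/ffunP => i; apply: val_inj; have := ef i; rewrite !ffunE.
  apply/val_inj/(inj_map val_inj); rewrite /=.
  rewrite -(insert_zeros_dropK (sz_map g)) -(insert_zeros_dropK (sz_map g')).
  congr drop_zeros; apply: (@eq_from_nth _ 0%N); first by rewrite !sz_word.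
  by move=> i; rewrite sz_word => lt_i; have := eg (Ordinal lt_i); rewrite !ffunE.
have h_lab x : labelled v (h x).
  move=> i; rewrite /h /= ffunE (tnth_nth false).
  have -> : nth false v i = (nth 0%N (word (map val x.1)) i == 0%N).
    rewrite -(nth_map 0%N false (fun y => y == 0%N)) ?sz_word //.
    by rewrite insert_zerosK.
  by split=> [->|/eqP].
(* In a nonzero term, the letters have content [lam] and are thus below [N], while the area is at
   most the [q]-degree of [m], which bounds every height. *)
have T_out p : labelled v p -> ~ (range h) p -> T p.1 p.2 = 0.
  case: p => gamma pi lab not_h; apply: contra_notP not_h => /= T0.
  have def_pi k : #|[pred i | pi i == k]| = nth 0%N lam k.
    move: k; apply: contrapT => npi; apply: T0.
    by rewrite /T coef_xmon asboolF // mulr0.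
  have lt_pi i : (pi i < N)%N.
    rewrite ltnS leqNgt; apply/negP => /ltnW le_pi.
    have := def_pi (pi i); rewrite nth_default // => /card0_eq /(_ i).
    by rewrite inE eqxx.
  have le_area : (area gamma <= m ord0)%N.
    rewrite leqNgt; apply/negP => lt_m; apply: T0.
    by rewrite /T -mulrA mulrC (smallMl _ (@small_qX _)).
  pose s := [seq gamma i | i <- enum 'I_n].
  have szs : size s = n by rewrite size_map size_enum_ord.
  have nth_s (i : 'I_n) : nth 0%N s i = gamma i.
    by rewrite (nth_map i) ?size_enum_ord // nth_ord_enum.
  have def_v : map (fun x => x == 0%N) s = v.
    apply: (@eq_from_nth _ false); first by rewrite size_map szs.
    move=> i; rewrite size_map szs => lt_i; rewrite (nth_map 0%N) ?szs //.
    rewrite (nth_s (Ordinal lt_i)) -[i in RHS]/(val (Ordinal lt_i)) -tnth_nth.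
    by apply/eqP/idP => /(lab (Ordinal lt_i)).
  have szg : size (drop_zeros s) = count negb v.
    by rewrite size_map size_filter -def_v count_map.
  have def_s : insert_zeros v (drop_zeros s) = s by rewrite -{1}def_v drop_zerosK.
  have areaE : area gamma = sumn (drop_zeros s).
    by apply: (@area_insert_zeros _ v) => // i; rewrite def_s nth_s.
  have [|g def_g] := @map_tuple_ord _ D _ szg.
    apply/allP => x xs; apply: leq_ltn_trans lt_mD; apply: leq_trans le_area.
    by rewrite areaE sumnE (big_rem x) //= leq_addr.
  exists (g, [ffun i => Ordinal (lt_pi i)]) => //.
  rewrite /h /=; congr (_, _); apply/ffunP => i; rewrite !ffunE //.
  by rewrite def_g /word def_s nth_s.
transitivity (\sum_(p \in labelled v) T p.1 p.2); first by [].
transitivity (\sum_(p \in range h) T p.1 p.2).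
  apply/esym/fsbig_widen => [p [x _ <-]|p [lab not_h]]; first exact: h_lab.
  exact: T_out.
rewrite fsbig_image; last by move=> x y _ _; exact: h_inj.
pose r := index_enum ((count negb v).-tuple 'I_D * {ffun 'I_n -> 'I_N})%type.
rewrite (@fsbig_list _ _ _ r) ?index_enum_uniq //; last first.
  by move=> x _; rewrite mem_index_enum.
rewrite /r -(pair_bigA _ (fun g f => T (h (g, f)).1 (h (g, f)).2)) /=.
rewrite /llt_sum /bsum coef_fps_sum; apply: eq_bigr => g _.
rewrite /llt big_distrr coef_fps_sum [RHS]big_mkcond /=; apply: eq_bigr => f _.
rewrite /T coef_xmon (@area_insert_zeros _ v _ (map val g)) //; last first.
  by move=> i; rewrite ffunE.
rewrite (@dinv_ascents _ _ _ _ (word (map val g)) f); last 2 first.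
- by move=> i; rewrite ffunE.
- by move=> i; rewrite ffunE.
have fibE k : #|[pred i : 'I_n | [ffun i => val (f i)] i == k]| = #|fiber f k|.
  by apply: eq_card => i; rewrite !inE ffunE.
case: (has_contentP _ (leqnSn _)) => fs.
  by rewrite asboolT ?mulr1 // => k; rewrite fibE.
by rewrite asboolF ?mulr0 // => fs'; apply: fs => k; rewrite -fibE.
Qed.

(** * Comparison of both sides modulo powers of [q] *)

Theorem theorem2p5 (n : nat) (v : n.-tuple bool) :
  f_ v = \sum_(d < n.+1) hall (L v) (e_ (n - d) * h_ d) *: 'X^d.
Proof.
have szv : size v = n := size_tuple v.
have sz_word g : size (insert_zeros v g) = n by rewrite size_insert_zeros.
suff coef_f d : (f_ v)`_d = if (d <= n)%N then hall (L v) (e_ (n - d) * h_ d) else 0.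
  rewrite -(poly_def n.+1 (fun d => hall (L v) (e_ (n - d) * h_ d))).
  by apply/polyP => d; rewrite coef_poly coef_f.
(* The bound [k + n] on the heights is the one under which [partial_f] is exact modulo [q ^ k]. *)
apply/eqP; rewrite -subr_eq0; apply/eqP/small_eq0 => k; pose D := (k + n)%N.
have approx : small k ((f_ v)`_d - (partial_f D v)`_d).
  by rewrite -coefB; apply: partial_f_limit; rewrite szv.
suff : small k ((partial_f D v)`_d -
    (if (d <= n)%N then hall (L v) (e_ (n - d) * h_ d) else 0)).
  by move=> approx'; have := smallD approx approx'; rewrite addrA subrK.
rewrite /partial_f /bsum coef_sum.
have coef_term (g : (count negb v).-tuple 'I_D) :
    ((q ^+ sumn (map val g))%:P * weight [::] (insert_zeros v (map val g)))`_d =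
    q ^+ sumn (map val g) * if (d <= n)%N
      then star_llt (@attack n (insert_zeros v (map val g))) t (n - d) [:: d] else 0.
  rewrite coefCM (weight_attack (sz_word _)); congr (_ * _).
  case: leqP => [le_dn|lt_nd]; first by rewrite star_llt_hook ?card_ord.
  rewrite nth_default // -big_enum /=.
  set E := attack _.
  rewrite (eq_bigr (fun i => 'X - (- t ^+ out_deg E [set: 'I_n]%SET i)%:P)).
    by rewrite size_prod_XsubC size_enum_ord.
  by move=> i _; rewrite rmorphN opprK addrC.
under eq_bigr => g _ do rewrite coef_term.
case: leqP => [le_dn|lt_nd]; last first.
  rewrite big1 ?subr0 // => g _; exact: mulr0.
have [s [s_part def_s] sN] := e_h_expansion (n - d) [:: d].
rewrite (@hallE _ _ s) //; last by rewrite -def_s /h_part big_seq1.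
(* For each [g] the starred sums obey the recurrence of the pairing with [e_ j], so the list [s]
   that expands [e_ (n - d) * h_ d] also expresses them through [llt_sum]. *)
pose N j b := bsum (count negb v) D (fun g =>
  q ^+ sumn g * star_llt (@attack n (insert_zeros v g)) t j b).
have def_N : N (n - d)%N [:: d] = \sum_(p <- s) p.1 * llt_sum v D p.2.
  apply: sN => [b|j b].
    apply: eq_bsum => g _; congr (_ * _).
    apply: (@star_llt_base _ _ _ _ (@reading n (insert_zeros v g))).
      exact: reading_inj.
      exact: attack_unit_interval.
    by rewrite perm_sort.
  rewrite /N; under eq_bigr => i _ do rewrite /bsum big_distrr /=.
  rewrite exchange_big big1 // => g _.
  transitivity (q ^+ sumn (map val g) * \sum_(i < j.+2) (-1) ^+ i *
      star_llt (@attack n (insert_zeros v (map val g))) t (j.+1 - i)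
        (if val i is 0 then b else val i :: b)).
    by rewrite big_distrr; apply: eq_bigr => i _; rewrite mulrCA.
  rewrite (@sum_star_llt _ _ _ _ (reading (insert_zeros v (map val g)))) ?mulr0 //.
  by move=> x y; rewrite attackE => /andP[].
rewrite -/(bsum _ _ (fun g =>
  q ^+ sumn g * star_llt (@attack n (insert_zeros v g)) t (n - d) [:: d])).
rewrite -/(N (n - d)%N [:: d]) def_N -sumrB; apply: small_sum => p _.
rewrite -mulrBr; apply: smallMl.
rewrite -opprB -mulN1r; apply: smallMl => m mk; apply: (@L_llt_sum _ _ D).
by apply: leq_trans mk _; rewrite leq_addr.
Qed.
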